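(* Let $A$ be a ring, let $X=\{X_{\lambda}\}_{\lambda\in\Lambda}$ be a set of indeterminates (indexed by an arbitrary set $\Lambda$), and let $R=A[X]$ be the polynomial ring. Assume that $A$ is reduced and arithmetical. Then, for each prime ideal $P$ of $R$ such that $P^n$ is finitely generated for some integer $n>0$, $P$ is finitely generated.
   Context: All rings are commutative with identity. A ring is a chain ring if its lattice of ideals is totally ordered by inclusion. A ring $A$ is arithmetical if the localization $A_M$ is a chain ring for each maximal ideal $M$ of $A$. *)

(* Defs.v *)
From HB Require Import structures.
From mathcomp Require Import all_boot all_algebra.
From mathcomp Require Import generic_quotient ring.
From mathcomp Require Import boolp classical_sets.

Set Implicit Arguments.
Unset Strict Implicit.
Unset Printing Implicit Defensive.

Import GRing.Theory.
Local Open Scope ring_scope.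
Local Open Scope classical_set_scope.
Local Open Scope quotient_scope.

(* Ideals are classical sets.  The structure [idealr] of ring_quotient is not
   used because it only describes proper ideals. *)
Section Ideals.
Variable R : comPzRingType.
Implicit Types I J M P S : set R.

Definition is_ideal I : Prop :=
  [/\ I 0, forall x y, I x -> I y -> I (x + y)
         & forall a x, I x -> I (a * x)].

Definition prime_ideal P : Prop :=
  [/\ is_ideal P, ~ P 1 & forall x y, P (x * y) -> P x \/ P y].

Definition maximal_ideal M : Prop :=
  [/\ is_ideal M, ~ M 1
    & forall J, is_ideal J -> M `<=` J -> J = M \/ J = setT].

Definition ideal_span S : set R := smallest is_ideal S.

Definition ideal_mul I J : set R :=
  ideal_span [set z | exists x y, [/\ I x, J y & z = x * y]].

Definition ideal_exp I n : set R := iter n (ideal_mul I) setT.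

Definition finitely_generated I : Prop :=
  exists s : seq R, I = ideal_span [set x | x \in s].

Lemma maximal_ideal_prime M : maximal_ideal M -> prime_ideal M.
Proof.
move=> [[M0 MD MM] M1 Mmax]; split=> // x y Mxy.
have [|nMx] := pselect (M x); [by left|right].
pose J : set R := [set z | exists2 m, M m & exists a, z = m + a * x].
have JI : is_ideal J.
  split.
  - by exists 0 => //; exists 0; rewrite mul0r addr0.
  - move=> _ _ [m Mm [a ->]] [m' Mm' [a' ->]].
    by exists (m + m'); [exact: MD|exists (a + a')]; ring.
  - move=> b _ [m Mm [a ->]].
    by exists (b * m); [exact: MM|exists (b * a)]; ring.
have MJ : M `<=` J by move=> m Mm; exists m => //; exists 0; ring.
case: (Mmax J JI MJ) => JE.
  by case: nMx; rewrite -JE; exists 0 => //; exists 1; ring.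
have [m Mm [a E1]] : J 1 by rewrite JE.
have -> : y = y * m + a * (x * y).
  by rewrite -[LHS]mulr1 E1; ring.
by apply: MD; apply: MM.
Qed.

End Ideals.

Definition reduced (R : comPzRingType) : Prop :=
  forall (x : R) (n : nat), x ^+ n = 0 -> x = 0.

Definition chain_ring (R : comPzRingType) : Prop :=
  forall I J : set R, is_ideal I -> is_ideal J -> I `<=` J \/ J `<=` I.

(* The localization of [A] at a prime ideal [P]: the quotient of the set of
   pairs [(a, s)] with [s] outside of [P] by the relation
   [(a, s) ~ (b, t) <-> exists u outside of P, u * (a * t) = u * (b * s)].
   [A] may have zero divisors, so [fraction] does not apply. *)
Section Localization.
Variables (A : comPzRingType) (P : set A) (primeP : prime_ideal P).

Definition loc_den : Type := {s : A | `[< ~ P s >]}.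
HB.instance Definition _ := Choice.on loc_den.

Definition den (s : loc_den) : A := val s.
Arguments den : simpl never.

Definition loc_pair : Type := (A * loc_den)%type.
HB.instance Definition _ := Choice.on loc_pair.

Implicit Types (s t : loc_den) (x y z : loc_pair).

Fact denN s : ~ P (den s). Proof. exact/asboolP/(valP s). Qed.

Fact den1_subproof : `[< ~ P 1 >].
Proof. by case: primeP => _ P1 _; apply/asboolP. Qed.

Fact denM_subproof s t : `[< ~ P (den s * den t) >].
Proof.
by case: primeP => _ _ PM; apply/asboolP => /PM[]; apply: denN.
Qed.

Definition den1 : loc_den := exist _ 1 den1_subproof.
Definition denM s t : loc_den := exist _ (den s * den t) (denM_subproof s t).

Fact den1E : den den1 = 1. Proof. by []. Qed.
Fact denME s t : den (denM s t) = den s * den t. Proof. by []. Qed.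
Let denE := (den1E, denME).

Definition loc_eq x y : bool :=
  `[< exists u : loc_den,
        den u * (x.1 * den y.2) = den u * (y.1 * den x.2) >].

Fact loc_eqP x y :
  reflect (exists u : loc_den,
             den u * (x.1 * den y.2) = den u * (y.1 * den x.2)) (loc_eq x y).
Proof. exact: asboolP. Qed.

Fact loc_eq_refl : reflexive loc_eq.
Proof. by move=> x; apply/loc_eqP; exists den1. Qed.

Fact loc_eq_sym : symmetric loc_eq.
Proof. by move=> x y; apply/loc_eqP/loc_eqP => -[u]; exists u. Qed.

Fact loc_eq_trans : transitive loc_eq.
Proof.
move=> y x z /loc_eqP[u E] /loc_eqP[v F]; apply/loc_eqP.
exists (denM (denM u v) y.2) => /=; rewrite ?denE.
transitivity (den v * den z.2 * (den u * (x.1 * den y.2))); first by ring.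
rewrite E.
transitivity (den u * den x.2 * (den v * (y.1 * den z.2))); first by ring.
by rewrite F; ring.
Qed.

Canonical loc_equiv := EquivRel loc_eq loc_eq_refl loc_eq_sym loc_eq_trans.

Definition localization : Type := {eq_quot loc_equiv}.
HB.instance Definition _ : EqQuotient _ loc_eq localization :=
  EqQuotient.on localization.
HB.instance Definition _ := Choice.on localization.

Definition pair_add x y : loc_pair :=
  (x.1 * den y.2 + y.1 * den x.2, denM x.2 y.2).
Definition pair_opp x : loc_pair := (- x.1, x.2).
Definition pair_mul x y : loc_pair := (x.1 * y.1, denM x.2 y.2).

Definition loc_frac (a : A) s : localization := \pi_localization (a, s).
Definition loc_add := lift_op2 localization pair_add.
Definition loc_opp := lift_op1 localization pair_opp.
Definition loc_mul := lift_op2 localization pair_mul.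

Let pi_eq x y : (x = y %[mod localization]) <-> loc_eq x y.
Proof. by split => [/eqmodP|H]; last exact/eqmodP. Qed.

Fact pi_loc_add :
  {morph \pi_localization : x y / pair_add x y >-> loc_add x y}.
Proof.
move=> x y; unlock loc_add; apply/pi_eq.
have /loc_eqP[u E] : loc_eq x (repr (\pi_localization x)).
  by apply/pi_eq; rewrite reprK.
have /loc_eqP[v F] : loc_eq y (repr (\pi_localization y)).
  by apply/pi_eq; rewrite reprK.
move: (repr (\pi_localization x)) (repr (\pi_localization y)) E F => x' y' E F.
apply/loc_eqP; exists (denM u v) => /=; rewrite ?denE.
transitivity (den v * den y.2 * den y'.2 * (den u * (x.1 * den x'.2))
            + den u * den x.2 * den x'.2 * (den v * (y.1 * den y'.2))).
  by ring.
by rewrite E F; ring.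
Qed.

Fact pi_loc_opp : {morph \pi_localization : x / pair_opp x >-> loc_opp x}.
Proof.
move=> x; unlock loc_opp; apply/pi_eq.
have /loc_eqP[u E] : loc_eq x (repr (\pi_localization x)).
  by apply/pi_eq; rewrite reprK.
by apply/loc_eqP; exists u => /=; rewrite !mulNr !mulrN E.
Qed.

Fact pi_loc_mul :
  {morph \pi_localization : x y / pair_mul x y >-> loc_mul x y}.
Proof.
move=> x y; unlock loc_mul; apply/pi_eq.
have /loc_eqP[u E] : loc_eq x (repr (\pi_localization x)).
  by apply/pi_eq; rewrite reprK.
have /loc_eqP[v F] : loc_eq y (repr (\pi_localization y)).
  by apply/pi_eq; rewrite reprK.
move: (repr (\pi_localization x)) (repr (\pi_localization y)) E F => x' y' E F.
apply/loc_eqP; exists (denM u v) => /=; rewrite ?denE.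
transitivity ((den u * (x.1 * den x'.2)) * (den v * (y.1 * den y'.2))).
  by ring.
by rewrite E F; ring.
Qed.

Let loc_ind (Q : localization -> Prop) :
  (forall x, Q (\pi_localization x)) -> forall q, Q q.
Proof. by move=> H q; rewrite -[q]reprK. Qed.

Local Ltac loc_ring :=
  apply/pi_eq/loc_eqP; exists den1 => /=; rewrite ?denE; ring.

Fact loc_addA : associative loc_add.
Proof.
elim/loc_ind=> x; elim/loc_ind=> y; elim/loc_ind=> z.
by rewrite -!pi_loc_add; loc_ring.
Qed.

Fact loc_addC : commutative loc_add.
Proof.
elim/loc_ind=> x; elim/loc_ind=> y.
by rewrite -!pi_loc_add; loc_ring.
Qed.

Fact loc_add0 : left_id (loc_frac 0 den1) loc_add.
Proof.
elim/loc_ind=> x.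
by rewrite -!pi_loc_add; loc_ring.
Qed.

Fact loc_addN : left_inverse (loc_frac 0 den1) loc_opp loc_add.
Proof.
elim/loc_ind=> x.
rewrite -pi_loc_opp -pi_loc_add.
by loc_ring.
Qed.

HB.instance Definition _ := GRing.isZmodule.Build localization
  loc_addA loc_addC loc_add0 loc_addN.

Fact loc_mulA : associative loc_mul.
Proof.
elim/loc_ind=> x; elim/loc_ind=> y; elim/loc_ind=> z.
by rewrite -!pi_loc_mul; loc_ring.
Qed.

Fact loc_mulC : commutative loc_mul.
Proof.
elim/loc_ind=> x; elim/loc_ind=> y.
by rewrite -!pi_loc_mul; loc_ring.
Qed.

Fact loc_mul1 : left_id (loc_frac 1 den1) loc_mul.
Proof.
elim/loc_ind=> x.
by rewrite -!pi_loc_mul; loc_ring.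
Qed.

Fact loc_mulDl : left_distributive loc_mul loc_add.
Proof.
elim/loc_ind=> x; elim/loc_ind=> y; elim/loc_ind=> z.
rewrite -!(pi_loc_mul, pi_loc_add).
by loc_ring.
Qed.

HB.instance Definition _ := GRing.Zmodule_isComPzRing.Build localization
  loc_mulA loc_mulC loc_mul1 loc_mulDl.

Lemma loc_frac_surj (q : localization) : exists a s, q = loc_frac a s.
Proof. by elim/loc_ind: q => -[a s]; exists a, s. Qed.

Lemma loc_frac_eq a b s t : loc_frac a s = loc_frac b t <->
  exists u : loc_den, den u * (a * den t) = den u * (b * den s).
Proof.
by split=> [/pi_eq/loc_eqP //|H]; apply/pi_eq/loc_eqP.
Qed.

Lemma loc_fracD a b s t :
  loc_frac a s + loc_frac b t = loc_frac (a * den t + b * den s) (denM s t).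
Proof. by rewrite /loc_frac -[LHS]pi_loc_add. Qed.

Lemma loc_fracM a b s t :
  loc_frac a s * loc_frac b t = loc_frac (a * b) (denM s t).
Proof. by rewrite /loc_frac -[LHS]pi_loc_mul. Qed.

Lemma loc_frac1 : 1 = loc_frac 1 den1. Proof. by []. Qed.

End Localization.

Definition arithmetical (A : comPzRingType) : Prop :=
  forall (M : set A) (maxM : maximal_ideal M),
    chain_ring (localization (maximal_ideal_prime maxM)).

(* Main.v *)
Require Import Defs.
From mathcomp Require Import all_boot all_algebra.
From mathcomp Require Import finmap zify ring.
From mathcomp Require Import boolp classical_sets.
From mathcomp Require Import monalg.

Set Implicit Arguments.
Unset Strict Implicit.
Unset Printing Implicit Defensive.

Import GRing.Theory.
Local Open Scope ring_scope.
Local Open Scope classical_set_scope.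

(* Put p = P \cap A and let N be the kernel of A -> A_p.  Since A is
   locally a valuation domain, A/N is a Pruefer domain, and N A[X] vanishes
   locally at the primes containing P; hence it is enough to generate P modulo
   N A[X].  Choose a finite subset J of P with J^n = P^n and look at the colon
   ideal (J^n : J^(n-1)), which contains P.  If, modulo N A[X], it is not
   contained in P, Nakayama's lemma gives u outside of P killing J^(n-1), hence
   killing x^n for all x in P, and P = N A[X] because N A[X] is prime.  Otherwise
   P is, modulo N A[X], the projection of a module of relations S over A[X], and
   S is saturated: a f in S with a outside of N implies f in S.

   It remains to see that, in finitely many variables, a saturated submodule S of
   A[X]^m is finitely generated modulo N.  At a prime q of A take, for each degree
   bound d, the leading monomials modulo q of the elements of S of degree at most
   d.  By Dickson's lemma finitely many g_i in S account for all of them.  If f in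
   S has degree at most d, Gaussian elimination by monomial multiples of the g_i
   gives a f = g + f', where f' has no coefficient at these leading monomials;
   dividing f' by its content at q would produce a new leading monomial, so f' = 0
   modulo N.  The factor a is a unit not only at q but at every prime of a
   constructible neighbourhood of q that does not depend on f, and compactness of
   the constructible topology concludes. *)

(** * Ideals and primes *)

Section Ideals.
Variable R : comPzRingType.
Implicit Types (I P Q S : set R) (s l : seq R).

Lemma ideal0 I : is_ideal I -> I 0. Proof. by case. Qed.

Lemma idealD I x y : is_ideal I -> I x -> I y -> I (x + y).
Proof. by case=> _ ID _; apply: ID. Qed.

Lemma idealM I a x : is_ideal I -> I x -> I (a * x).
Proof. by case=> _ _ IM; apply: IM. Qed.

Lemma idealMr I a x : is_ideal I -> I x -> I (x * a).
Proof. by rewrite mulrC; apply: idealM. Qed.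

Lemma idealB I x y : is_ideal I -> I x -> I y -> I (x - y).
Proof.
move=> II Ix Iy; rewrite -mulN1r; apply: (idealD II) => //.
exact: (idealM _ II).
Qed.

Lemma ideal_sum I (T : eqType) (r : seq T) (B : pred T) (F : T -> R) :
  is_ideal I -> (forall i, i \in r -> B i -> I (F i)) ->
  I (\sum_(i <- r | B i) F i).
Proof.
move=> II IF; rewrite big_seq_cond; elim/big_ind: _ => //.
- exact: ideal0.
- by move=> x y; apply: (idealD II).
- by move=> i /andP[]; apply: IF.
Qed.

Lemma ideal_prod I (T : eqType) (r : seq T) (F : T -> R) i :
  is_ideal I -> i \in r -> I (F i) -> I (\prod_(j <- r) F j).
Proof. by move=> II ir Fi; rewrite (big_rem i) //=; apply: (idealMr _ II). Qed.

Lemma ideal_top I : is_ideal I -> I 1 -> I = setT.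
Proof. by move=> II I1; apply/seteqP; split=> // x _; 
  rewrite -[x]mulr1; apply: (idealM _ II). Qed.

Lemma is_ideal_span S : is_ideal (ideal_span S).
Proof.
split.
- by move=> I [II _]; apply: ideal0.
- by move=> x y Ix Iy I SI; apply: (idealD SI.1); [apply: Ix|apply: Iy].
- by move=> a x Ix I SI; apply: (idealM _ SI.1); apply: Ix.
Qed.

Lemma sub_ideal_span S : S `<=` ideal_span S.
Proof. by move=> x Sx I [_]; apply. Qed.

Lemma ideal_span_min S I : is_ideal I -> S `<=` I -> ideal_span S `<=` I.
Proof. by move=> II SI x; apply. Qed.

Lemma prime_is_ideal P : prime_ideal P -> is_ideal P. Proof. by case. Qed.

Lemma primeM P x y : prime_ideal P -> ~ P x -> ~ P y -> ~ P (x * y).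
Proof. by case=> _ _ PM nx ny /PM[]. Qed.

Lemma prime_exp P x n : prime_ideal P -> P (x ^+ n) -> P x.
Proof.
move=> [_ P1 PM]; elim: n => [|n IHn]; first by rewrite expr0.
by rewrite exprS => /PM[].
Qed.

Definition span_seq s : set R := ideal_span [set x | x \in s].

Lemma span_seq_is_ideal s : is_ideal (span_seq s).
Proof. exact: is_ideal_span. Qed.

Lemma mem_span_seq s x : x \in s -> span_seq s x.
Proof. by move=> xs; apply: sub_ideal_span. Qed.

Lemma span_seq_min s I : is_ideal I -> (forall x, x \in s -> I x) -> span_seq s `<=` I.
Proof. exact: ideal_span_min. Qed.

Lemma span_seq_sub s l : (forall x, x \in s -> x \in l) -> span_seq s `<=` span_seq l.
Proof.
move=> sl; apply: span_seq_min; first exact: span_seq_is_ideal.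
by move=> x /sl; apply: mem_span_seq.
Qed.

Lemma span_seq_sum s x : span_seq s x ->
  exists c : 'I_(size s) -> R, x = \sum_i c i * tnth (in_tuple s) i.
Proof.
move: x; apply: span_seq_min.
  split.
  - by exists (fun=> 0); rewrite big1 // => i _; rewrite mul0r.
  - move=> _ _ [c ->] [d ->]; exists (fun i => c i + d i).
    by rewrite -big_split; apply: eq_bigr => i _; rewrite /= mulrDl.
  - move=> a _ [c ->]; exists (fun i => a * c i).
    by rewrite mulr_sumr; apply: eq_bigr => i _; rewrite mulrA.
move=> x xs; have ix : (index x s < size s)%N by rewrite index_mem.
exists (fun i => (i == Ordinal ix)%:R).
rewrite (bigD1 (Ordinal ix)) //= eqxx mul1r big1 ?addr0.
  by rewrite (tnth_nth 0) /= nth_index.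
by move=> i /negPf->; rewrite mul0r.
Qed.

Lemma span_seq_cons a s x : span_seq (a :: s) x ->
  exists c, exists2 y, span_seq s y & x = c * a + y.
Proof.
move: x; apply: span_seq_min.
  split.
  - by exists 0, 0; [exact: ideal0 (span_seq_is_ideal _)|ring].
  - move=> _ _ [c [y Iy ->]] [d [z Iz ->]]; exists (c + d), (y + z); last by ring.
    exact: idealD (span_seq_is_ideal s) Iy Iz.
  - move=> b _ [c [y Iy ->]]; exists (b * c), (b * y); last by ring.
    exact: idealM (span_seq_is_ideal s) Iy.
move=> x; rewrite inE => /predU1P[->|xs].
  by exists 1, 0; [exact: ideal0 (span_seq_is_ideal _)|ring].
by exists 0, x; [apply: mem_span_seq|ring].
Qed.

(* Compactness of the spectrum for the constructible topology: [good l] should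
   be read as a property of the closed set of the primes containing [l]. *)
Lemma exists_not_good_prime (good : seq R -> Prop) :
  (forall l l', (forall x, x \in l -> span_seq l' x) -> good l -> good l') ->
  (forall a b l, good (a :: l) -> good (b :: l) -> good (a * b :: l)) ->
  good [:: 1] -> ~ good [::] ->
  exists P, [/\ prime_ideal P, forall l, (forall x, x \in l -> P x) -> ~ good l
    & forall a, ~ P a ->
        exists l, (forall x, x \in l -> P x) /\ good (a :: l)].
Proof.
move=> mono goodM good1 ngood.
pose bad P := forall l, (forall x, x \in l -> P x) -> ~ good l.
(* [P] is maximal among all subsets without a good finite list, not only among ideals. A finite list
   in the union of a chain lies in one member or is empty. *)
have [F Fbad Ftot|P [Pbad Pmax]] := @Zorn_bigcup R bad.
  move=> l lF gl.
  have [E|[X FX lX]] : l = [::] \/ exists2 X, F X & forall x, x \in l -> X x.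
    elim: l lF {gl} => [|a l IHl] lF; [by left|right].
    have [X FX Xa] := lF a (mem_head a l).
    case: IHl => [x xl|->|[Y FY lY]]; first by apply: lF; rewrite inE xl orbT.
      by exists X => // x; rewrite inE => /eqP->.
    case: (Ftot X Y FX FY) => XY; [exists Y|exists X] => // x.
      by rewrite inE => /predU1P[->|/lY//]; apply: XY.
    by rewrite inE => /predU1P[->//|/lY Yx]; apply: XY.
  - by apply: ngood; rewrite -E.
  - exact: (Fbad X FX l lX).
have mem l l' : {subset l <= l'} -> good l -> good l'.
  by move=> ll'; apply: mono => x /ll'; apply: mem_span_seq.
have out a : ~ P a -> exists l, (forall x, x \in l -> P x) /\ good (a :: l).
  move=> Pa; apply: contrapT => H; apply: (Pmax (P `|` [set a])).
    by split=> [x Px|PaP]; [left|apply/Pa/PaP; right].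
  move=> l lP gl; apply: H; exists [seq x <- l | x != a]; split.
    move=> x; rewrite mem_filter => /andP[/eqP xa /lP[]//].
  apply: mem gl => x xl; rewrite inE mem_filter xl andbT.
  by case: eqP.
(* The ideal axioms for [P] reduce to this: if an element spanned by a list in [P] were outside [P],
   monotonicity would make some list in [P] good. *)
have in0 l x a : (forall y, y \in l -> P y) ->
    good (a :: x) -> (forall y, y \in x -> P y) -> span_seq l a -> False.
  move=> lP ga xP la; apply: (Pbad (l ++ x)).
    by move=> y; rewrite mem_cat => /orP[/lP|/xP].
  apply: mono ga => y; rewrite inE => /predU1P[->|yx].
    by apply: span_seq_sub la => z zl; rewrite mem_cat zl.
  by apply: mem_span_seq; rewrite mem_cat yx orbT.
have Pid : is_ideal P.
  split.
  - apply: contrapT => /out[l [lP gl]].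
    by apply: (in0 [::] l 0) => //; exact: ideal0 (span_seq_is_ideal _).
  - move=> x y Px Py; apply: contrapT => /out[l [lP gl]].
    apply: (in0 [:: x; y] l (x + y)) => //.
      by move=> z; rewrite !inE => /orP[]/eqP->.
    by apply: (idealD (span_seq_is_ideal _)); apply: mem_span_seq;
      rewrite !inE eqxx ?orbT.
  - move=> a x Px; apply: contrapT => /out[l [lP gl]].
    apply: (in0 [:: x] l (a * x)) => //; first by move=> z; rewrite inE => /eqP->.
    by apply: (idealM _ (span_seq_is_ideal _)); apply: mem_span_seq; rewrite inE.
exists P; split=> //; split=> //.
  by move=> P1; apply: (Pbad [:: 1]) => // x; rewrite inE => /eqP->.
move=> x y Pxy; apply: contrapT => /not_orP[/out[l [lP gl]] /out[l' [lP' gl']]].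
apply: (Pbad (x * y :: (l ++ l'))).
  by move=> z; rewrite inE mem_cat => /or3P[/eqP->|/lP|/lP'].
by apply: goodM; [apply: mem gl|apply: mem gl'] => z;
  rewrite !inE mem_cat => /orP[->//|->]; rewrite ?orbT.
Qed.

(** Call [l] good if I + (l) = R. The prime given by compactness is maximal: each a outside it
    satisfies I + (a, l) = R for some [l] inside it, and it contains [I]. *)
Lemma exists_maximal I : is_ideal I -> ~ I 1 ->
  exists2 M, maximal_ideal M & I `<=` M.
Proof.
move=> II I1; pose good l := exists2 i, I i & span_seq l (1 - i).
have [l l' ll' [i Ii Si]|a b l [i Ii Si] [j Ij Sj]|||P [Pprime Pbad Pout]] :=
    @exists_not_good_prime good.
- exists i => //; move: Si; apply: span_seq_min => //; exact: span_seq_is_ideal.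
- have [c [y Sy Ey]] := span_seq_cons Si.
  have [d [z Sz Ez]] := span_seq_cons Sj.
  exists (i + j - i * j).
    by apply: (idealB II); [apply: (idealD II)|apply: (idealM _ II)].
  have -> : 1 - (i + j - i * j) = (1 - i) * (1 - j) by ring.
  rewrite Ey Ez.
  have -> : (c * a + y) * (d * b + z)
     = c * d * (a * b) + (c * a * z + d * b * y + y * z) by ring.
  have SI := span_seq_is_ideal (a * b :: l).
  have S1 w : span_seq l w -> span_seq (a * b :: l) w.
    by apply: span_seq_sub => x xl; rewrite inE xl orbT.
  apply: (idealD SI).
    by apply: (idealM _ SI); apply: mem_span_seq; rewrite inE eqxx.
  by repeat apply: (idealD SI); apply: (idealM _ SI); apply: S1.
- exists 0; first exact: ideal0.
  by rewrite subr0; apply: mem_span_seq; rewrite inE.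
- case=> i Ii /(span_seq_min (I := [set 0])) H.
  apply: I1; have/subr0_eq->// : 1 - i = 0.
  by apply: H => //; split=> // [x y ->->|a x ->]; rewrite ?addr0 ?mulr0.
have IP : I `<=` P.
  move=> i Ii; apply: contrapT => /Pout[l [lP [j Ij /span_seq_cons[c [y Sy E]]]]].
  apply: (Pbad l lP); exists (j + c * i).
    by apply: (idealD II) => //; apply: (idealM _ II).
  by rewrite opprD addrA E addrAC subrr add0r.
exists P => //; split; [by case: Pprime..|move=> J JI PJ].
have [JP|/existsNP[a /not_implyP[Ja nPa]]] := pselect (J `<=` P).
  by left; apply/seteqP.
right; apply: ideal_top => //.
have [l [lP [j Ij /span_seq_cons[c [y Sy E]]]]] := Pout a nPa.
have -> : 1 = j + (c * a + y) by rewrite -E; ring.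
apply: (idealD JI); first exact/PJ/IP.
apply: (idealD JI); first exact: (idealM _ JI).
by move: y Sy {E}; apply: span_seq_min => // x /lP /PJ.
Qed.

Lemma exists_prime I : is_ideal I -> ~ I 1 -> exists2 P, prime_ideal P & I `<=` P.
Proof.
by move=> II /exists_maximal-/(_ II)[M /maximal_ideal_prime Mp IM]; exists M.
Qed.

(* The kernel of the localization at [P]. *)
Definition loc_ker P : set R := [set a | exists2 v, ~ P v & v * a = 0].

Lemma loc_ker_ideal P : prime_ideal P -> is_ideal (loc_ker P).
Proof.
move=> PP; split.
- by exists 1; [case: PP|rewrite mulr0].
- move=> x y [v Pv vx] [w Pw wy]; exists (v * w); first exact: primeM.
  have -> : v * w * (x + y) = w * (v * x) + v * (w * y) by ring.
  by rewrite vx wy !mulr0 addr0.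
- by move=> a x [v Pv vx]; exists v => //; rewrite mulrCA vx mulr0.
Qed.

Lemma common_annihilator P (T : eqType) (r : seq T) (F : T -> R) :
  prime_ideal P -> (forall i, i \in r -> loc_ker P (F i)) ->
  exists2 u, ~ P u & forall i, i \in r -> u * F i = 0.
Proof.
move=> PP; elim: r => [|i r IHr] Fr; first by exists 1; case: PP.
have [v Pv vi] := Fr i (mem_head _ _).
have [j jr|u Pu ur] := IHr; first by apply: Fr; rewrite inE jr orbT.
exists (v * u); first exact: primeM.
move=> j; rewrite inE => /predU1P[->|/ur uj]; first by rewrite mulrAC vi mul0r.
by rewrite -mulrA uj mulr0.
Qed.

Lemma loc_ker_sub P : prime_ideal P -> loc_ker P `<=` P.
Proof.
move=> [PI P1 PM] a [v Pv va]; have := ideal0 PI.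
by rewrite -va => /PM[].
Qed.

End Ideals.

(** * Divisibility at a prime of an arithmetical ring *)

Section Arithmetical.
Variable A : comNzRingType.

(** For a maximal ideal M containing [q], the ideals of A_M generated by a/1 and b/1 are comparable.
    Clearing denominators gives [s] outside M, hence outside [q]. *)
Lemma arithmetical_dvd (arithA : arithmetical A) (q : set A) (a b : A) :
  prime_ideal q -> exists2 s, ~ q s & exists c, s * a = c * b \/ s * b = c * a.
Proof.
move=> [qI q1 _]; have [M maxM qM] := exists_maximal qI q1.
pose pM := maximal_ideal_prime maxM.
pose J (x : A) : set (localization pM) :=
  [set z | exists y, z = y * loc_frac pM x (den1 pM)].
have JI x : is_ideal (J x).
  split.
  - by exists 0; rewrite mul0r.
  - by move=> _ _ [y ->] [z ->]; exists (y + z); rewrite mulrDl.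
  - by move=> c _ [y ->]; exists (c * y); rewrite mulrA.
have key x y : J x `<=` J y -> exists2 s, ~ q s & exists c, s * x = c * y.
  move=> /(_ (loc_frac pM x (den1 pM)))[].
    by exists 1; rewrite mul1r.
  move=> z; have [c [t ->]] := loc_frac_surj z.
  rewrite loc_fracM => /loc_frac_eq[u].
  rewrite !denME !den1E !mulr1 => E.
  exists (den u * den t); first by move=> /qM; rewrite -denME; apply: denN.
  by exists (den u * c); rewrite -mulrA [_ * x]mulrC E mulrA.
case: (arithA M maxM (J a) (J b)) => // /key[s qs [c E]]; exists s => //;
  exists c; [by left|by right].
Qed.

(** A reduced chain ring is a domain: if a is a multiple of b at [q], then a^2 is a multiple of ab =
    0 there, so a vanishes at [q]. *)
Lemma loc_ker_prime (redA : reduced A) (arithA : arithmetical A) (q : set A) :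
  prime_ideal q -> prime_ideal (loc_ker q).
Proof.
move=> qP; split; first exact: loc_ker_ideal.
  by case=> v qv; rewrite mulr1 => v0; apply: qv;
    rewrite v0; exact: ideal0 (prime_is_ideal qP).
move=> a b [v qv vab].
have key x y s c : ~ q s -> v * (x * y) = 0 -> s * x = c * y -> loc_ker q x.
  move=> qs vxy E; exists (v * s); first exact: primeM.
  apply: (redA _ 2); rewrite expr2.
  have -> : v * s * x * (v * s * x) = v * s * (v * (x * (s * x))) by ring.
  by rewrite E [x * _]mulrCA [v * (c * _)]mulrCA vxy !mulr0.
have [s qs [c [E|E]]] := arithmetical_dvd arithA a b qP; [left|right].
  exact: key E.
by apply: key E => //; rewrite mulrC [b * a]mulrC mulrC.
Qed.

(** Divisibility at [q] is total, so among finitely many values one divides all the others. It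
    serves as the content, with common denominator [s]. *)
Lemma exists_content (arithA : arithmetical A) (q : set A) (T : eqType)
    (r : seq T) (F : T -> A) :
  prime_ideal q -> r != [::] ->
  exists2 t, t \in r & exists2 s, ~ q s &
    forall u, u \in r -> exists c, s * F u = c * F t.
Proof.
move=> qP; have [_ q1 _] := qP.
elim: r => // a r IHr _; have [->|r0] := eqVneq r [::].
  exists a; rewrite ?inE //; exists 1 => // u; rewrite inE => /eqP->.
  by exists 1.
have [t tr [s qs sF]] := IHr r0.
have [s' qs' [c [E|E]]] := arithmetical_dvd arithA (F a) (F t) qP.
  exists t; first by rewrite inE tr orbT.
  exists (s * s'); first exact: primeM.
  move=> u; rewrite inE => /predU1P[->|/sF[d Ed]].
    by exists (s * c); rewrite -mulrA E mulrA.
  by exists (s' * d); rewrite mulrAC Ed; ring.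
exists a; first exact: mem_head.
exists (s * s'); first exact: primeM.
move=> u; rewrite inE => /predU1P[->|/sF[d Ed]]; first by exists (s * s').
by exists (d * c); rewrite -[RHS]mulrA -E mulrAC Ed; ring.
Qed.

End Arithmetical.

(** * Monomials and polynomials *)

Section Monomials.
Variable L : choiceType.
Implicit Types (Z : seq L) (a b c m : {cmonom L}).

(** [Z] supplies the order of the variables, [L] being a bare choice type; totality holds on the
    monomials in [Z]. *)
Fixpoint lexlt Z a b : bool :=
  if Z is z :: Z' then (a z < b z)%N || (a z == b z) && lexlt Z' a b else false.

Definition in_vars Z a := forall z, z \notin Z -> a z = 0%N.

Lemma lexlt_irr Z : irreflexive (lexlt Z).
Proof. by move=> a; elim: Z => //= z Z ->; rewrite ltnn andbF. Qed.

Lemma lexlt_trans Z : transitive (lexlt Z).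
Proof.
move=> b a c; elim: Z => //= z Z IHZ.
case/orP=> [ab|/andP[/eqP-> ab]] /orP[bc|/andP[/eqP bc' bc]].
- by rewrite (ltn_trans ab bc).
- by rewrite -bc' ab.
- by rewrite bc.
- by rewrite bc' eqxx IHZ ?orbT.
Qed.

Lemma lexlt_total Z a b : in_vars Z a -> in_vars Z b -> a != b ->
  lexlt Z a b || lexlt Z b a.
Proof.
move=> Za Zb; apply: contraR => H; apply/cmP => z.
have [zZ|/[dup]/Za-> /Zb->//] := boolP (z \in Z).
elim: Z zZ H {Za Zb} => //= y Z IHZ; rewrite inE => yZ.
by case: ltngtP => //= ab H; case/predU1P: yZ => [->//|/IHZ]; apply.
Qed.

Lemma lexlt_mul Z m a b : lexlt Z (mmul m a) (mmul m b) = lexlt Z a b.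
Proof. by elim: Z => //= z Z ->; rewrite !cmM ltn_add2l eqn_add2l. Qed.

Lemma mmulI m : injective (mmul m).
Proof.
move=> a b E; apply/eqP/cmP => z; apply: (@addnI (m z)).
by rewrite -!cmM E.
Qed.

Lemma in_varsM Z a b : in_vars Z (mmul a b) <-> in_vars Z a /\ in_vars Z b.
Proof.
split=> [H|[Ha Hb] z zZ]; last by rewrite cmM Ha ?Hb.
by split=> z /H/eqP; rewrite cmM addn_eq0 => /andP[/eqP ? /eqP].
Qed.

Lemma in_vars_sub Z Z' a : {subset Z <= Z'} -> in_vars Z a -> in_vars Z' a.
Proof. by move=> ZZ' Za z zZ'; apply: Za; apply: contra zZ' => /ZZ'. Qed.

Fixpoint monoms Z d : seq {cmonom L} :=
  if d is d'.+1 then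
    monoms Z d' ++ [seq mmul (ucm z) a | z <- Z, a <- monoms Z d']
  else [:: mone].

Lemma mem_monoms Z d a : in_vars Z a -> (mdeg a <= d)%N -> a \in monoms Z d.
Proof.
elim: d a => [|d IHd] a Za /=.
  by rewrite leqn0 mdeg_eq0 inE.
move=> ad; rewrite mem_cat; have [|lt_da] := leqP (mdeg a) d.
  by move=> /IHd->.
apply/orP; right.
have [z az] : exists z, a z != 0%N.
  apply: contrapT => /forallNP H; move: lt_da.
  suff -> : a = mone by rewrite mdeg1.
  by apply/eqP/cmP => z; rewrite cm1; apply/eqP/negP => /negP/H.
have zZ : z \in Z by apply: contraR az => /Za->.
have E : a = mmul (ucm z) (divcm a (ucm z)).
  apply/eqP/cmP => y; rewrite cmM divcmE ucmE subnKC //.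
  by case: eqP => // <-; rewrite lt0n.
apply/allpairsP; exists (z, divcm a (ucm z)); split=> //=.
apply: IHd; first by move: Za; rewrite {1}E => /in_varsM[].
by rewrite -ltnS; move: ad; rewrite {1}E mdegM mdegU.
Qed.

End Monomials.

Lemma exists_max (T : eqType) (lt : rel T) (P : T -> Prop) (s : seq T) :
  irreflexive lt -> transitive lt -> (exists2 x, x \in s & P x) ->
  exists x, [/\ x \in s, P x & forall y, y \in s -> P y -> ~~ lt x y].
Proof.
move=> irr tr; elim: s => [[//]|a s IHs] [x xs Px].
have [[y ys Py]|H] := pselect (exists2 y, y \in s & P y).
  have [z [zs Pz zmax]] := IHs (ex_intro2 _ _ y ys Py).
  have [za|nza] := pselect (P a /\ lt z a).
    exists a; split; [exact: mem_head|by case: za|].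
    move=> t; rewrite inE => /predU1P[-> _|ts Pt]; first by rewrite irr.
    apply/negP => at_; have /negP := zmax t ts Pt; apply.
    by apply: tr at_; case: za.
  exists z; split=> //; first by rewrite inE zs orbT.
  move=> t; rewrite inE => /predU1P[-> Pa|]; last exact: zmax.
  by apply/negP => zat; apply: nza.
move: xs; rewrite inE => /predU1P[xa|xs]; last by case: H; exists x.
exists x; rewrite -xa mem_head; split=> // t; rewrite inE => /predU1P[->|ts Pt].
  by rewrite irr.
by case: H; exists t.
Qed.

Section Polynomials.
Variables (A : comNzRingType) (L : choiceType).
Local Notation R := {malg A[{cmonom L}]}.
Implicit Types (f g : R) (Z : seq L) (K : set A).

Definition pvars f : seq L :=
  flatten [seq enum_fset (finsupp (a : {cmonom L})) | a <- msupp f].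

Definition poly_in Z f := forall a, a \in msupp f -> in_vars Z a.

Lemma poly_in_pvars f : poly_in (pvars f) f.
Proof.
move=> a af z; apply: contraNeq; rewrite cmE_neq0 => za.
by apply/flatten_mapP; exists a.
Qed.

Lemma poly_in_sub Z Z' f : {subset Z <= Z'} -> poly_in Z f -> poly_in Z' f.
Proof. by move=> ZZ' Zf a /Zf; apply: in_vars_sub. Qed.

Definition ext_ideal K : set R := [set f | forall a, K f@_a].

Lemma ext_ideal_is_ideal K : is_ideal K -> is_ideal (ext_ideal K).
Proof.
move=> KI; split.
- by move=> a; rewrite mcoeff0; apply: ideal0.
- by move=> f g Kf Kg a; rewrite mcoeffD; apply: (idealD KI).
- move=> f g Kg a; rewrite mcoeffMl; apply: ideal_sum => // k _ _.
  apply: ideal_sum => // k' _ _; case: eqP => _; last exact: ideal0.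
  by rewrite mulr1n; apply: (idealM _ KI).
Qed.

Lemma ext_ideal_out K f : is_ideal K -> ~ ext_ideal K f ->
  exists2 a, a \in msupp f & ~ K f@_a.
Proof.
move=> KI /existsNP[a Ka]; exists a => //.
by apply: contrapT => /negP/mcoeff_outdom fa0; apply: Ka; rewrite fa0; apply: ideal0.
Qed.

(** If [a] and [b] are the largest monomials of f and g with coefficients outside [K], the
    coefficient of f g at ab is f_a g_b modulo [K]. *)
Lemma ext_ideal_prime K : prime_ideal K -> prime_ideal (ext_ideal K).
Proof.
move=> KP; have KI := prime_is_ideal KP; split.
- exact: ext_ideal_is_ideal.
- by move/(_ mone); rewrite mcoeff1 eqxx => K1; case: KP.
move=> f g Kfg; apply: contrapT => /not_orP[].
move=> /(ext_ideal_out KI) Kf /(ext_ideal_out KI) Kg.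
pose Z := pvars f ++ pvars g.
have Zf : poly_in Z f.
  by apply: (poly_in_sub _ (@poly_in_pvars f)) => z zf; rewrite mem_cat zf.
have Zg : poly_in Z g.
  by apply: (poly_in_sub _ (@poly_in_pvars g)) => z zf; rewrite mem_cat zf orbT.
have [a [af Ka amax]] := exists_max (@lexlt_irr L Z) (@lexlt_trans L Z) Kf.
have [b [bg Kb bmax]] := exists_max (@lexlt_irr L Z) (@lexlt_trans L Z) Kg.
apply: (primeM KP Ka Kb); have := Kfg (mmul a b).
rewrite mcoeffMl (bigD1_seq a) ?fset_uniq //= (bigD1_seq b) ?fset_uniq //=.
rewrite eqxx mulr1n -addrA => Kab.
set S := (X in _ + X) in Kab.
rewrite -[_ * _](addrK S); apply: (idealB KI) => //; apply: (idealD KI).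
  apply: ideal_sum => // k kg kb; case: eqP => [/mmulI E|_]; last exact: ideal0.
  by rewrite E eqxx in kb.
apply: ideal_sum => // k kf ka; apply: ideal_sum => // k' kg _.
case: eqP => [E|_]; last exact: ideal0.
rewrite mulr1n; have [|fk] := pselect (K f@_k); first exact: (idealMr _ KI).
apply: (idealM _ KI); apply: contrapT => gk.
(* Another factorization of ab with both coefficients outside [K] would have k < a and k' < b, hence
   k k' < ab. *)
have /orP[kLa|] := lexlt_total (Zf _ kf) (Zf _ af) ka; last first.
  by apply/negP/amax.
have [E'|kb] := eqVneq k' b.
  move: E; rewrite E' mulmC [mmul a b]mulmC => /mmulI E.
  by rewrite E eqxx in ka.
have /orP[kLb|] := lexlt_total (Zg _ kg) (Zg _ bg) kb; last first.
  by apply/negP/bmax.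
have : lexlt Z (mmul k k') (mmul a b).
  apply: (@lexlt_trans _ _ (mmul k b)); first by rewrite lexlt_mul.
  by rewrite mulmC [mmul a b]mulmC lexlt_mul.
by rewrite E lexlt_irr.
Qed.

End Polynomials.

(** Induction on [K]. If [s] dominates in the first [K] coordinates and [B] bounds its next one,
    points at height at least [B] are dominated by [s], and each of the [B] lower slices is handled
    by induction. The map [v] lets points carry further data. *)
Lemma dickson (T : eqType) (K : nat) (v : T -> nat -> nat) (E : set T) :
  exists s : seq T, (forall x, x \in s -> E x) /\
    forall x, E x -> exists2 y, y \in s & forall j, (j < K)%N -> (v y j <= v x j)%N.
Proof.
elim: K E => [|K IHK] E.
  have [[x Ex]|H] := pselect (exists x, E x).
    by exists [:: x]; split=> [y|y _]; [rewrite inE => /eqP->|exists x; rewrite ?inE].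
  by exists [::]; split=> // x Ex; case: H; exists x.
have [s [sE sdom]] := IHK E.
pose B := (\max_(x <- s) v x K)%N.
have [s' [sE' sdom']] : exists s' : seq T, (forall x, x \in s' -> E x) /\
    forall x, E x -> (v x K < B)%N ->
      exists2 y, y \in s' & forall j, (j < K.+1)%N -> (v y j <= v x j)%N.
  elim: B => [|b [s' [sE' sdom']]]; first by exists [::].
  have [s2 [s2E s2dom]] := IHK [set x | E x /\ v x K = b].
  exists (s' ++ s2); split.
    by move=> x; rewrite mem_cat => /orP[/sE'|/s2E[]].
  move=> x Ex; rewrite ltnS leq_eqVlt => /orP[/eqP xb|xb]; last first.
    by have [y ys H] := sdom' x Ex xb; exists y; rewrite // mem_cat ys.
  have [y ys H] := s2dom x (conj Ex xb); exists y; first by rewrite mem_cat ys orbT.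
  move=> j; rewrite ltnS leq_eqVlt => /orP[/eqP->|]; last exact: H.
  by have [_ ->] := s2E y ys; rewrite xb.
exists (s ++ s'); split.
  by move=> x; rewrite mem_cat => /orP[/sE|/sE'].
move=> x Ex; have [xB|Bx] := ltnP (v x K) B.
  by have [y ys H] := sdom' x Ex xB; exists y; rewrite // mem_cat ys orbT.
have [y ys H] := sdom x Ex; exists y; first by rewrite mem_cat ys.
move=> j; rewrite ltnS leq_eqVlt => /orP[/eqP->|]; last exact: H.
by apply: leq_trans Bx; apply: (@leq_bigmax_seq _ s xpredT (fun x => v x K)).
Qed.

(** * Elimination without division *)

Section Elimination.
Variables (A : comNzRingType) (V : zmodType) (T : eqType).
Variables (sc : A -> V -> V) (cf : T -> V -> A).
Hypothesis cfB : forall t v w, cf t (v - w) = cf t v - cf t w.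
Hypothesis cfZ : forall t a v, cf t (sc a v) = a * cf t v.

(* Fraction-free Gaussian elimination; [Un] and [In] play the roles of the units
   and of the Jacobson radical. *)
Lemma gauss (Un In : set A) (W : set V) (lt : rel T) (E : seq T) (h : T -> V) v :
  Un 1 -> (forall a b, Un a -> Un b -> Un (a * b)) ->
  (forall a b, Un a -> In b -> Un (a - b)) -> is_ideal In ->
  W 0 -> (forall v w, W v -> W w -> W (v - w)) ->
  (forall a v, W v -> W (sc a v)) ->
  pairwise (fun t u => lt u t) E ->
  (forall t, t \in E -> [/\ Un (cf t (h t)), W (h t)
     & forall u, u \in E -> lt t u -> In (cf u (h t))]) ->
  exists2 d, Un d & exists2 w, W w &
    forall t, t \in E -> cf t (sc d v - w) = 0.
Proof.
move=> Un1 UnM UnD InI; elim: E W h v => [|t E IHE] W h v W0 WB WZ /=.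
  by exists 1 => //; exists 0.
move=> /andP[/allP tE sE] hE; have [Ut Wt _] := hE t (mem_head _ _).
(* Cross-multiplication clears column [t]. As [E] is decreasing, [cf t (h u)] is in [In], so each
   new pivot is a product of pivots minus an element of [In]. *)
pose h' u := sc (cf t (h t)) (h u) - sc (cf t (h u)) (h t).
pose v' := sc (cf t (h t)) v - sc (cf t v) (h t).
have [||||d Ud [g [Wg gt] gE]] := IHE [set w | W w /\ cf t w = 0] h' v' _ _ _ sE.
- by split=> //; rewrite -(subrr 0) cfB subrr.
- by move=> w w' [Ww w0] [Ww' w0']; split; [apply: WB|rewrite cfB w0 w0' subrr].
- by move=> a w [Ww w0]; split; [apply: WZ|rewrite cfZ w0 mulr0].
- move=> u uE; have [Uu Wu Iu] := hE u (mem_behead (s := t :: E) uE).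
  have Iut : In (cf t (h u)) by apply: Iu; [exact: mem_head|exact: tE].
  split.
  + by rewrite cfB !cfZ; apply: UnD; [exact: UnM|exact: (idealMr _ InI)].
  + by split; [apply: WB; apply: WZ|rewrite cfB !cfZ; ring].
  + move=> w wE uw; rewrite cfB !cfZ; apply: (idealB InI).
      by apply: (idealM _ InI); apply: Iu uw; rewrite inE wE orbT.
    exact: (idealMr _ InI).
exists (d * cf t (h t)); first exact: UnM.
exists (g - sc (- (d * cf t v)) (h t)).
  by apply: WB => //; apply: WZ.
move=> u uE.
have -> : cf u (sc (d * cf t (h t)) v - (g - sc (- (d * cf t v)) (h t)))
    = cf u (sc d v' - g).
  by rewrite !(cfB, cfZ); ring.
move: uE; rewrite inE => /predU1P[->|/gE//].
by rewrite !(cfB, cfZ) gt; ring.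
Qed.

End Elimination.

(** * Terms and coefficients in a free module over the polynomial ring *)

Section FreeModule.
Variables (A : comNzRingType) (L : choiceType) (m : nat).
Local Notation Mon := {cmonom L}.
Local Notation R := {malg A[Mon]}.
Local Notation V := 'rV[R]_m.
Local Notation T := (Mon * 'I_m)%type.
Implicit Types (f g h : V) (t u : T) (Z : seq L) (W : set V).

Definition cf f t : A := (f 0 t.2)@_t.1.

Lemma cfP f g : (forall t, cf f t = cf g t) -> f = g.
Proof.
move=> H; apply/rowP => i; apply/malgP => a; exact: (H (a, i)).
Qed.

Lemma cf0 t : cf 0 t = 0. Proof. by rewrite /cf mxE mcoeff0. Qed.

Lemma cfB f g t : cf (f - g) t = cf f t - cf g t.
Proof. by rewrite /cf !mxE mcoeffB. Qed.

Lemma cfZ (a : A) f t : cf (a%:MP *: f) t = a * cf f t.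
Proof. by rewrite /cf mxE mcoeffCM. Qed.

Lemma cf_monom (mu : Mon) f t : cf (<< mu >> *: f) (mmul mu t.1, t.2) = cf f t.
Proof.
rewrite /cf mxE mcoeffMl msuppU1 big_seq_fset1 mcoeffU1 eqxx /=.
have [tf|tf] := boolP (t.1 \in msupp (f 0 t.2)).
  rewrite (bigD1_seq t.1) ?fset_uniq //= eqxx mul1r mulr1n big1 ?addr0 // => k kt.
  by case: eqP => // /mmulI E; rewrite E eqxx in kt.
rewrite big_seq big1 ?mcoeff_outdom // => k kf; case: eqP => // /mmulI E.
by rewrite -E kf in tf.
Qed.

Lemma cf_monom_neq0 (mu : Mon) f t : cf (<< mu >> *: f) t != 0 ->
  exists2 a, t.1 = mmul mu a & cf f (a, t.2) != 0.
Proof.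
rewrite /cf mxE mcoeff_neq0 => tf; have [k1 [k2 [k1mu kf ->]]] := msuppM_le tf.
have -> : k1 = mu by apply/fset1P; rewrite -(@msuppU1 _ A).
exists k2 => //=.
by rewrite mcoeff_neq0.
Qed.

(** The position-over-term extension of [lexlt]. *)
Definition tlt Z t u : bool :=
  (t.2 < u.2)%N || (t.2 == u.2) && lexlt Z t.1 u.1.

Lemma tlt_irr Z : irreflexive (tlt Z).
Proof. by move=> t; rewrite /tlt ltnn eqxx lexlt_irr. Qed.

Lemma tlt_trans Z : transitive (tlt Z).
Proof.
move=> [b j] [a i] [c k]; rewrite /tlt /=.
case/orP=> [ij|/andP[/eqP-> ab]] /orP[jk|/andP[/eqP <- bc]].
- by rewrite (ltn_trans ij jk).
- by rewrite ij.
- by rewrite jk.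
- by rewrite eqxx (lexlt_trans ab bc) orbT.
Qed.

Lemma tlt_total Z t u : in_vars Z t.1 -> in_vars Z u.1 -> t != u ->
  tlt Z t u || tlt Z u t.
Proof.
case: t u => a i [b j] /= Za Zb; rewrite /tlt /=.
have [<- ab|ij _] := eqVneq i j.
  rewrite ltnn /=; apply: lexlt_total => //.
  by apply: contra_neq ab => ->.
by rewrite /= !orbF -neq_ltn.
Qed.

Lemma tlt_mul Z (mu a b : Mon) (i j : 'I_m) :
  tlt Z (mmul mu a, i) (mmul mu b, j) = tlt Z (a, i) (b, j).
Proof. by rewrite /tlt /= lexlt_mul. Qed.

Definition terms Z d : seq T := [seq (a, i) | a <- undup (monoms Z d), i <- enum 'I_m].

Lemma mem_terms Z d t : (t \in terms Z d) = (t.1 \in monoms Z d).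
Proof.
case: t => a i /=; apply/allpairsP/idP => [[[b j] /= [bZ _ [-> _]]]|aZ].
  by rewrite -mem_undup.
by exists (a, i); rewrite /= mem_undup aZ mem_enum.
Qed.

Definition bounded Z d f :=
  forall t, cf f t != 0 -> in_vars Z t.1 /\ (mdeg t.1 <= d)%N.

Lemma bounded_terms Z d f t : bounded Z d f -> cf f t != 0 -> t \in terms Z d.
Proof. by move=> Hf /Hf[]; rewrite mem_terms; apply: mem_monoms. Qed.

Lemma boundedB Z d f g : bounded Z d f -> bounded Z d g -> bounded Z d (f - g).
Proof.
move=> Hf Hg t; rewrite cfB; have [->|/Hf//] := eqVneq (cf f t) 0.
by rewrite sub0r oppr_eq0; apply: Hg.
Qed.

Lemma boundedZ Z d a f : bounded Z d f -> bounded Z d (a%:MP *: f).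
Proof.
move=> Hf t; rewrite cfZ; have [->|/Hf//] := eqVneq (cf f t) 0.
by rewrite mulr0 eqxx.
Qed.

Definition submod W :=
  [/\ W 0, forall f g, W f -> W g -> W (f + g) & forall (r : R) f, W f -> W (r *: f)].

End FreeModule.

(** * Saturated submodules of free modules *)

Section SaturatedSubmodules.
Variables (A : comNzRingType) (L : choiceType) (m : nat) (Z : seq L).
Local Notation Mon := {cmonom L}.
Local Notation R := {malg A[Mon]}.
Local Notation V := 'rV[R]_m.
Local Notation T := (Mon * 'I_m)%type.
Implicit Types (f g h : V) (t u : T) (G : seq V) (q : set A).

Hypothesis arithA : arithmetical A.
Variables (N : set A) (S : set V).
Hypotheses (primeN : prime_ideal N) (submodS : submod S).
Hypothesis satS : forall a f, ~ N a -> S (a%:MP *: f) -> S f.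

Lemma submodB (W : set V) f g : submod W -> W f -> W g -> W (f - g).
Proof. by move=> [_ WD WZ] Wf Wg; rewrite -scaleN1r; apply: WD => //; apply: WZ. Qed.

(** Membership in (G) + N A[X]^m, in a form that applies at once to any submodule [W] given by a
    property. *)
Definition spanned G f := forall W : set V, submod W ->
  (forall h, (forall t, N (cf h t)) -> W h) -> (forall g, g \in G -> W g) -> W f.

Lemma spanned_submod G : submod (spanned G).
Proof.
split.
- by move=> W [].
- by move=> f g Gf Gg W WW WN WG; case: (WW) => _ WD _; apply: WD; [apply: Gf|apply: Gg].
- by move=> r f Gf W WW WN WG; case: (WW) => _ _ WZ; apply: WZ; apply: Gf.
Qed.

Lemma spanned_sub G G' f : {subset G <= G'} -> spanned G f -> spanned G' f.
Proof. by move=> GG' Gf W WW WN WG; apply: Gf => // g /GG'; apply: WG. Qed.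

Lemma spanned_mem G g : g \in G -> spanned G g.
Proof. by move=> gG W _ _; apply. Qed.

Lemma spanned_null G h : (forall t, N (cf h t)) -> spanned G h.
Proof. by move=> hN W _ WN _; apply: WN. Qed.

Definition lead q d f t :=
  [/\ S f, bounded Z d f, ~ q (cf f t) & forall u, tlt Z t u -> q (cf f u)].

Lemma notin_neq0 q a : is_ideal q -> ~ q a -> a != 0.
Proof. by move=> qI qa; apply/eqP => a0; apply: qa; rewrite a0; apply: ideal0. Qed.

Lemma exists_lead q d f t : is_ideal q -> S f -> bounded Z d f -> ~ q (cf f t) ->
  exists u, lead q d f u.
Proof.
move=> qI Sf bf qt.
have : exists2 u, u \in terms m Z d & ~ q (cf f u).
  by exists t => //; apply: bounded_terms bf (notin_neq0 qI qt).
move=> /(exists_max (@tlt_irr L m Z) (@tlt_trans L m Z))[u [_ qu umax]].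
exists u; split=> // w uw; apply: contrapT => qw; 
have wE : w \in terms m Z d by apply: bounded_terms bf (notin_neq0 qI qw).
by have := umax w wE qw; rewrite uw.
Qed.

Lemma lead_mem q d f t : is_ideal q -> lead q d f t ->
  in_vars Z t.1 /\ (mdeg t.1 <= d)%N.
Proof. by move=> qI [_ bf qt _]; apply/bf/(notin_neq0 qI qt). Qed.

Lemma cf_sum (c : T -> A) (s : seq Mon) t : uniq s ->
  cf (\row_i \sum_(a <- s) << c (a, i) *g a >> : V) t = c t *+ (t.1 \in s).
Proof.
case: t => a i us; rewrite /cf mxE raddf_sum [fst _]/= [snd _]/=.
rewrite (eq_bigr (fun b => c (b, i) *+ (b == a))); last by move=> b _; apply: mcoeffU.
have [as_|as_] := boolP (a \in s).
  rewrite (bigD1_seq a) //= eqxx big1 => [|b /negPf->]; last exact: mulr0n.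
  by rewrite addr0.
rewrite big_seq big1 // => b bs; case: eqP => [E|]; last by rewrite mulr0n.
by rewrite -E bs in as_.
Qed.

(* [g] is [f] divided by its content at [q], hence nonzero modulo [q]. *)
Lemma divide_content q d f t : prime_ideal q -> N `<=` q -> S f -> bounded Z d f ->
  ~ N (cf f t) ->
  exists g u, lead q d g u /\ cf f u != 0.
Proof.
move=> qP Nq Sf bf Nt; have qI := prime_is_ideal qP; have NI := prime_is_ideal primeN.
have tE : t \in terms m Z d by apply: bounded_terms bf (notin_neq0 NI Nt).
have [|t0 t0E [s qs sE]] := exists_content arithA (cf f) qP (r := terms m Z d).
  by case: (terms _ _ _) tE.
(* [c] holds the coefficients of the quotient of [s] f by its content; taking 0 wherever f vanishes
   preserves the degree bound. *)
have /choice[c cE] : forall u, exists c,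
    s * cf f u = c * cf f t0 /\ (cf f u = 0 -> c = 0).
  move=> u; have [->|fu] := eqVneq (cf f u) 0.
    by exists 0; rewrite mulr0 mul0r.
  have [c Ec] := sE u (bounded_terms bf fu); exists c; split=> // f0.
  by rewrite f0 eqxx in fu.
have Nt0 : ~ N (cf f t0).
  move=> Nt0; apply: (primeM primeN (x := s) (y := cf f t) _ Nt); first by move/Nq.
  by have [-> _] := cE t; apply: (idealM _ NI).
have [g gE] : exists g : V, forall u, cf g u = c u.
  exists (\row_i \sum_(a <- undup (monoms Z d)) << c (a, i) *g a >>) => u.
  rewrite cf_sum ?undup_uniq // mem_undup -(@mem_terms L m Z d u).
  have [_|uE] := boolP (u \in _); first by rewrite mulr1n.
  have [_ ->] := cE u; first exact: mul0rn.
  by apply/eqP; apply: contraNT uE; apply: bounded_terms.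
have E : (cf f t0)%:MP *: g = s%:MP *: f.
  apply: cfP => u; transitivity (cf f t0 * cf g u); first exact: cfZ.
  transitivity (s * cf f u); last by symmetry; exact: cfZ.
  by have [-> _] := cE u; rewrite gE mulrC.
have Sg : S g.
  by apply: satS Nt0 _; rewrite E; case: submodS => _ _; apply.
have bg : bounded Z d g.
  move=> u; rewrite gE => cu; apply: bf.
  by apply: contra_neq cu => fu; have [_ ->] := cE u.
(* Modulo [N] the coefficient of g at [t0] is [s], because f_t0 (s - c t0) = 0 and f_t0 is outside
   the prime [N]. *)
have qg : ~ q (cf g t0).
  rewrite gE => qc; apply: qs.
  rewrite -[s](subrK (c t0)); apply: (idealD qI _ qc); apply: Nq; apply: contrapT => Nsc.
  apply: (primeM primeN Nt0 Nsc); have [E0 _] := cE t0.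
  have -> : cf f t0 * (s - c t0) = s * cf f t0 - c t0 * cf f t0 by ring.
  by rewrite E0 subrr; apply: ideal0.
have [u gu] := exists_lead qI Sg bg qg; exists g, u; split; first exact: gu.
have [_ _ qu _] := gu; move: qu; rewrite gE => qu.
apply/eqP => fu; apply: qu; have [_ /(_ fu)->] := cE u; exact: ideal0.
Qed.


Lemma exists_sorted_terms d : exists E : seq T,
  [/\ pairwise (fun t u => tlt Z u t) E, forall t, in_vars Z t.1 ->
     (mdeg t.1 <= d)%N -> t \in E & forall t, t \in E -> in_vars Z t.1].
Proof.
pose D := [seq t <- undup (terms m Z d) | `[< in_vars Z t.1 >]].
pose le t u := tlt Z u t || (t == u).
have mD t : t \in D -> in_vars Z t.1 by rewrite mem_filter => /andP[/asboolP].
have le_tr : transitive le.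
  move=> b a c; rewrite /le => /orP[ba|/eqP->//] /orP[cb|/eqP<-].
    by rewrite (tlt_trans cb ba).
  by rewrite ba.
have le_tot : {in [in D] &, total le}.
  move=> t u /mD tZ /mD uZ; rewrite /le eq_sym.
  have [->|tu] := eqVneq u t; first by rewrite orbT.
  by rewrite !orbF orbC; apply: tlt_total => //; rewrite eq_sym.
exists (sort le D); split=> [|t tZ td|t]; last by rewrite mem_sort; apply: mD.
  have : pairwise le (sort le D).
    by rewrite -sorted_pairwise //; apply: (sort_sorted_in le_tot); apply/allP.
  have : pairwise [rel t u | t != u] (sort le D).
    by rewrite -uniq_pairwise sort_uniq filter_uniq ?undup_uniq.
  move=> ne le_D; have : pairwise [rel t u | (t != u) && le t u] (sort le D).
    by rewrite pairwise_relI ne.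
  by apply: sub_pairwise => t u /= /andP[/negPf tu]; rewrite /le tu orbF.
rewrite mem_sort mem_filter mem_undup mem_terms mem_monoms // andbT.
exact/asboolP.
Qed.

(* [d - mdeg _] is the exponent of a homogenizing variable; comparing both [i] and
   [m - i] forces the positions in the row vectors to be equal. *)
Definition coordinates (x : nat * V * T) (j : nat) : nat :=
  match j with
  | 0 => x.1.1 - mdeg x.2.1
  | 1 => x.2.2
  | 2 => m - x.2.2
  | k.+3 => nth 0 [seq (x.2.1 : Mon) z | z <- Z] k
  end.

Lemma coordinates_le d d' f f' (t u : T) : in_vars Z t.1 -> in_vars Z u.1 ->
  (forall j, (j < (size Z).+3)%N ->
    (coordinates (d, f, t) j <= coordinates (d', f', u) j)%N) ->
  [/\ t.2 = u.2, exists mu, u.1 = mmul mu t.1 & (d - mdeg t.1 <= d' - mdeg u.1)%N].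
Proof.
move=> tZ uZ H; split; last exact: (H 0).
- apply/val_inj/eqP; rewrite eqn_leq; have /= -> := H 1 isT.
  by have /= := H 2 isT; rewrite leq_sub2lE // ltnW.
- exists (divcm u.1 t.1); apply/eqP/cmP => z; rewrite cmM divcmE subnK //.
  have [zZ|zZ] := boolP (z \in Z); last by rewrite tZ.
  have := H (index z Z).+3; rewrite !ltnS index_mem => /(_ zZ) /=.
  by rewrite !(nth_map z) ?index_mem // nth_index.
Qed.

(** [F] and [s] cut out a constructible neighbourhood of [q]. That they and [G] depend neither on
    [d] nor on [f] is what the compactness argument needs. *)
Lemma local_finiteness q : prime_ideal q -> N `<=` q ->
  exists (F : seq A) (s : A) (G : seq V),
  [/\ forall x, x \in F -> q x, ~ q s, forall g, g \in G -> S g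
    & forall q', prime_ideal q' -> N `<=` q' -> (forall x, x \in F -> q' x) ->
        ~ q' s -> forall d f, S f -> bounded Z d f ->
        exists2 a, ~ q' a & spanned G (a%:MP *: f)].
Proof.
move=> qP Nq; have qI := prime_is_ideal qP.
(* A triple carries a degree bound, an element of [S] and its leading term modulo [q]. The bound is
   compared too, because a lexicographic leading term does not control the degree. *)
have [l [lE ldom]] := dickson (size Z).+3 coordinates
  [set x : nat * V * T | lead q x.1.1 x.1.2 x.2].
(* On the neighbourhood, the coefficients of the chosen elements that lie in [q] stay in [q'], and
   their leading coefficients stay outside [q']. *)
pose F := [seq c <- flatten [seq [seq cf x.1.2 t | t <- terms m Z x.1.1] | x <- l]
          | `[< q c >]].
pose s := \prod_(x <- l) cf x.1.2 x.2.
pose G := [seq x.1.2 | x <- l].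
have Fq x : x \in F -> q x by rewrite mem_filter => /andP[/asboolP].
have sq : ~ q s.
  rewrite /s big_seq; elim/big_ind: _; first by case: qP.
    by move=> a b qa qb; apply: primeM.
  by move=> x /lE[].
have GS g : g \in G -> S g by move=> /mapP[x /lE[Sx _ _ _] ->].
exists F, s, G; split=> //.
pose U := [set q' | [/\ prime_ideal q', N `<=` q', (forall x, x \in F -> q' x) & ~ q' s]].
suff main d f : S f -> bounded Z d f -> exists2 a,
    (forall q', U q' -> ~ q' a) & spanned G (a%:MP *: f).
  move=> q' qP' Nq' Fq' sq' d f Sf bf; have [a Ua Ga] := main d f Sf bf.
  by exists a => //; apply: Ua.
move=> Sf bf; have [E [Esort Emem Evars]] := exists_sorted_terms d.
pose E' := [seq t <- E | `[< exists g, lead q d g t >]].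
pose Q t h := [/\ forall q', U q' -> ~ q' (cf h t),
  [/\ spanned G h, S h & bounded Z d h] &
  forall u, tlt Z t u -> forall q', U q' -> q' (cf h u)].
(* [h t] is a monomial multiple of a chosen element, with leading term [t]; the comparison of d -
   mdeg keeps its terms in degree at most [d]. *)
have /choice[h hE] : forall t, exists h, t \in E' -> Q t h.
  move=> t; have [tE|] := boolP (t \in E'); last by exists 0.
  move: tE; rewrite mem_filter => /andP[/asboolP[g gt] tE].
  have [[[d0 g0] t0] /[dup] xl /lE/= gt0 le_x] := ldom (d, g, t) gt.
  have [tZ td] := lead_mem qI gt; have [tZ0 td0] := lead_mem qI gt0.
  have [t2 [mu Et1] dd] := coordinates_le tZ0 tZ le_x.
  have Et : t = (mmul mu t0.1, t0.2) by rewrite -Et1 t2; case: (t).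
  have gG : g0 \in G by apply/mapP; exists (d0, g0, t0).
  have [Sg0 bg0 qg0 gtop] := gt0.
  exists (<< mu >> *: g0) => _; split.
  - move=> q' [qP' _ _ sq']; rewrite Et => qc; apply: sq'.
    apply: (ideal_prod (prime_is_ideal qP') xl).
    by rewrite -(cf_monom mu g0 t0).
  - split; first by have [_ _ GZ] := spanned_submod G; apply: GZ; exact: spanned_mem.
      by have [_ _ SZ] := submodS; apply: SZ.
    move=> u /cf_monom_neq0[a Eu ga]; have [aZ ad] := bg0 (a, u.2) ga.
    rewrite Eu in_varsM; split; last first.
      by move: td td0 dd ad; rewrite Et1 !mdegM /=; lia.
    by split=> //; move: tZ; rewrite Et1 => /in_varsM[].
  - move=> u tu q' [qP' Nq' Fq' _].
    have [->|u0] := eqVneq (cf (<< mu >> *: g0) u) 0.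
      exact: ideal0 (prime_is_ideal qP').
    have [a Eu ga] := cf_monom_neq0 u0.
    have Eu' : u = (mmul mu a, u.2) by rewrite -Eu; case: (u).
    have ta : tlt Z t0 (a, u.2) by case: (t0) Et tu => b i ->; rewrite Eu' tlt_mul.
    rewrite Eu' (cf_monom mu g0 (a, u.2)); apply: Fq'.
    rewrite mem_filter; apply/andP; split; first exact/asboolP/gtop.
    apply/flatten_mapP; exists (d0, g0, t0) => //; apply/mapP; exists (a, u.2) => //.
    exact: bounded_terms bg0 ga.
pose W := [set g | [/\ spanned G g, S g & bounded Z d g]].
have Uprime q' : U q' -> prime_ideal q' by case.
(* The units are the elements outside every prime of [U], the radical consists of those inside every
   prime of [U]; so the multiplier [a] works on all of [U]. *)
have [|||||||||a Ua [g [Gg Sg bg] gE]] := @gauss A V T (fun a f => a%:MP *: f)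
  (fun t f => cf f t) (fun t f g => cfB f g t) (fun t a f => cfZ a f t)
  [set a | forall q', U q' -> ~ q' a] [set a | forall q', U q' -> q' a] W (tlt Z) E' h f.
- by move=> q' /Uprime[].
- by move=> a b Ua Ub q' Uq'; apply: primeM (Uprime _ Uq') (Ua _ Uq') (Ub _ Uq').
- move=> a b Ua Ib q' Uq' qab; apply: (Ua _ Uq'); rewrite -[a](subrK b).
  exact: idealD (prime_is_ideal (Uprime _ Uq')) qab (Ib _ Uq').
- split.
  + by move=> q' /Uprime/prime_is_ideal; apply: ideal0.
  + move=> x y Ix Iy q' Uq'.
    exact: idealD (prime_is_ideal (Uprime _ Uq')) (Ix _ Uq') (Iy _ Uq').
  + move=> b x Ix q' Uq'; exact: idealM (prime_is_ideal (Uprime _ Uq')) (Ix _ Uq').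
- split; first by case: (spanned_submod G).
    by case: submodS.
  by move=> t; rewrite cf0 eqxx.
- move=> f1 g1 [Gf1 Sf1 bf1] [Gg1 Sg1 bg1]; split.
  + exact: submodB (spanned_submod G) Gf1 Gg1.
  + exact: submodB submodS Sf1 Sg1.
  + exact: boundedB bf1 bg1.
- move=> a f1 [Gf1 Sf1 bf1]; split.
  + by have [_ _ GZ] := spanned_submod G; apply: GZ.
  + by have [_ _ SZ] := submodS; apply: SZ.
  + exact: boundedZ.
- exact/pairwise_filter.
- move=> t tE'; have [Ut Wt It] := hE t tE'; split=> // u _; exact: It.
exists a => //.
have Sf' : S (a%:MP *: f - g).
  by apply: submodB => //; have [_ _ SZ] := submodS; apply: SZ.
have bf' : bounded Z d (a%:MP *: f - g) by apply: boundedB bg; apply: boundedZ.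
(* The remainder vanishes on [E']. A coefficient outside [N] would, by [divide_content], yield a
   leading term modulo [q] where the remainder is nonzero, and such a term lies in [E']. *)
rewrite -[_ *: f](subrK g); have [_ GD _] := spanned_submod G.
apply: GD Gg; apply: spanned_null => t; apply: contrapT => Nt.
have [g' [u [g'u fu]]] := divide_content qP Nq Sf' bf' Nt.
move: fu; rewrite gE ?eqxx // mem_filter; apply/andP; split.
  by apply/asboolP; exists g'.
by have [uZ ud] := lead_mem qI g'u; apply: Emem.
Qed.

(** A list [l] is good if one finite [G] generates [S] modulo [N] locally at all primes containing
    [l] and [N]. If the empty list were not good, compactness would give a prime contradicting
    [local_finiteness]. *)
Theorem saturated_submodule_fg : exists G : seq V, (forall g, g \in G -> S g) /\
  forall d f, S f -> bounded Z d f -> spanned G f.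
Proof.
pose good (l : seq A) := exists G : seq V, (forall g, g \in G -> S g) /\
  forall q, prime_ideal q -> N `<=` q -> (forall x, x \in l -> q x) ->
  forall d f, S f -> bounded Z d f ->
    exists2 a, ~ q a & spanned G (a%:MP *: f).
have good_mono (l l' : seq A) :
    (forall x, x \in l -> span_seq l' x) -> good l -> good l'.
  move=> ll' [G [GS HG]]; exists G; split=> // q qP Nq l'q d f Sf bf.
  apply: HG bf => // x /ll' l'x.
  exact: span_seq_min (prime_is_ideal qP) l'q _ l'x.
have good_mem (l l' : seq A) : {subset l <= l'} -> good l -> good l'.
  by move=> ll'; apply: good_mono => x /ll'; apply: mem_span_seq.
have [[G [GS HG]]|ngood] := pselect (good [::]).
  exists G; split=> // d f Sf bf.
  have [_ GD GZ] := spanned_submod G.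
  pose I := [set a : A | spanned G (a%:MP *: f)].
  have II : is_ideal I.
    split.
    - have E : (0 : A)%:MP *: f = 0 by rewrite malgC0E; exact: scale0r.
      by rewrite /I /= E; case: (spanned_submod G).
    - move=> x y Ix Iy.
      have E : (x + y)%:MP *: f = x%:MP *: f + y%:MP *: f.
        by rewrite monalgUD; exact: scalerDl.
      by rewrite /I /= E; exact: GD Ix Iy.
    - move=> x y Iy.
      have E : (x * y)%:MP *: f = x%:MP *: (y%:MP *: f).
        by rewrite mpolyCM; symmetry; exact: scalerA.
      by rewrite /I /= E; exact: GZ Iy.
  have [I1|nI1] := pselect (I 1); first by move: I1; rewrite /I /= mpolyC1E scale1r.
  have [q qP Iq] := exists_prime II nI1.
  have Nq : N `<=` q.
    move=> a Na; apply: Iq; apply: spanned_null => t; rewrite (cfZ a f t).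
    exact: idealMr (prime_is_ideal primeN) Na.
  have [|a qa Ga] := HG q qP Nq _ d f Sf bf; first by [].
  by case: qa; apply: Iq.
have [||P [PP Pbad Pout]] := exists_not_good_prime good_mono _ _ ngood.
- move=> a b l [G [GS HG]] [G' [GS' HG']]; exists (G ++ G'); split.
    by move=> g; rewrite mem_cat => /orP[/GS|/GS'].
  move=> q qP Nq labq d f Sf bf; have [_ _ qM] := qP.
  have lq x : x \in l -> q x by move=> xl; apply: labq; rewrite inE xl orbT.
  have [qa|qb] := qM a b (labq _ (mem_head _ _)).
    have [|c qc Gc] := HG q qP Nq _ d f Sf bf.
      by move=> x; rewrite inE => /predU1P[->|/lq].
    by exists c => //; apply: spanned_sub Gc => g gG; rewrite mem_cat gG.
  have [|c qc Gc] := HG' q qP Nq _ d f Sf bf.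
    by move=> x; rewrite inE => /predU1P[->|/lq].
  by exists c => //; apply: spanned_sub Gc => g gG; rewrite mem_cat gG orbT.
- exists [::]; split=> // q [_ q1 _] _ q1'; case: q1; apply: q1'; exact: mem_head.
have NP : N `<=` P.
  move=> a Na; apply: contrapT => /Pout[l [lP [G [GS HG]]]].
  apply: (Pbad l lP); exists G; split=> // q qP Nq lq.
  by apply: HG => // x; rewrite inE => /predU1P[->|/lq//]; apply: Nq.
have [F [s [G [FP sP GS HG]]]] := local_finiteness PP NP.
have [l [lP [G' [GS' HG']]]] := Pout s sP.
(* The primes containing [F] and [l] split according to [s]: [G'] serves those containing [s], [G]
   the others. *)
case: (Pbad (F ++ l)); first by move=> x; rewrite mem_cat => /orP[/FP|/lP].
exists (G ++ G'); split.
  by move=> g; rewrite mem_cat => /orP[/GS|/GS'].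
move=> q qP Nq Flq d f Sf bf.
have [qs|qs] := pselect (q s).
  have [|a qa Ga] := HG' q qP Nq _ d f Sf bf.
    by move=> x; rewrite inE => /predU1P[->//|xl]; apply: Flq; rewrite mem_cat xl orbT.
  by exists a => //; apply: spanned_sub Ga => g gG; rewrite mem_cat gG orbT.
have [|a qa Ga] := HG q qP Nq _ qs d f Sf bf.
  by move=> x xF; apply: Flq; rewrite mem_cat xF.
by exists a => //; apply: spanned_sub Ga => g gG; rewrite mem_cat gG.
Qed.

End SaturatedSubmodules.

(** * Powers of a prime ideal *)

Section Powers.
Variable R : comPzRingType.
Implicit Types (P I : set R) (J gs : seq R).

Fixpoint prods J k : seq R :=
  if k is k'.+1 then [seq a * b | a <- J, b <- prods J k'] else [:: 1].

Lemma mem_prods J k a b : a \in J -> b \in prods J k -> a * b \in prods J k.+1.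
Proof. exact: allpairs_f. Qed.

Lemma prods_sub J J' k : {subset J <= J'} -> {subset prods J k <= prods J' k}.
Proof.
move=> JJ'; elim: k => //= k IHk x /allpairsP[[a b] /= [aJ bJ ->]].
by apply/allpairsP; exists (a, b); rewrite JJ' ?IHk.
Qed.

Lemma prods_ideal_exp P J k x : (forall y, y \in J -> P y) ->
  x \in prods J k -> ideal_exp P k x.
Proof.
move=> JP; elim: k x => // k IHk x /allpairsP[[a b] /= [/JP aP /IHk bP ->]].
by apply: sub_ideal_span; exists a, b.
Qed.

Lemma ideal_exp_expr P x k : P x -> ideal_exp P k (x ^+ k).
Proof.
move=> Px; elim: k => // k IHk; rewrite exprS.
by apply: sub_ideal_span; exists x, (x ^+ k).
Qed.

Lemma ideal_exp_prods P k x : ideal_exp P k x ->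
  exists2 J, (forall y, y \in J -> P y) & span_seq (prods J k) x.
Proof.
elim: k x => [|k IHk] x.
  exists [::] => //; rewrite -[x]mulr1; apply: (idealM _ (span_seq_is_ideal _)).
  exact: mem_span_seq (mem_head _ _).
pose I := [set x | exists2 J, (forall y, y \in J -> P y) & span_seq (prods J k.+1) x].
suff: ideal_exp P k.+1 `<=` I by apply.
apply: ideal_span_min.
  split.
  - by exists [::] => //; apply: ideal0 (span_seq_is_ideal _).
  - move=> y z [J JP Jy] [J' JP' Jz]; exists (J ++ J').
      by move=> t; rewrite mem_cat => /orP[/JP|/JP'].
    apply: (idealD (span_seq_is_ideal _)).
      by apply: span_seq_sub Jy; apply: prods_sub => t tJ; rewrite mem_cat tJ.
    by apply: span_seq_sub Jz; apply: prods_sub => t tJ; rewrite mem_cat tJ orbT.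
  - by move=> a y [J JP Jy]; exists J => //; apply: (idealM _ (span_seq_is_ideal _)).
move=> _ [a [b [Pa /IHk[J JP Jb] ->]]]; exists (a :: J).
  by move=> y; rewrite inE => /predU1P[->|/JP].
have SI := span_seq_is_ideal (prods (a :: J) k.+1).
suff: span_seq (prods J k) `<=` [set b | span_seq (prods (a :: J) k.+1) (a * b)] by apply.
apply: span_seq_min.
  split=> [|y z Iy Iz|c y Iy] /=; first by rewrite mulr0; apply: ideal0 SI.
    by rewrite mulrDr; apply: (idealD SI).
  by rewrite mulrCA; apply: (idealM _ SI).
move=> y yJ; apply: mem_span_seq; apply: mem_prods; first exact: mem_head.
by apply: prods_sub yJ => t tJ; rewrite inE tJ orbT.
Qed.

Lemma fg_ideal_exp P k : finitely_generated (ideal_exp P k) ->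
  exists2 J, (forall y, y \in J -> P y) &
    forall x, ideal_exp P k x -> span_seq (prods J k) x.
Proof.
move=> [s Es]; suff [J JP Js] : exists2 J, (forall y, y \in J -> P y) &
    forall x, x \in s -> span_seq (prods J k) x.
  exists J => // x; rewrite Es; move: x.
  exact: span_seq_min (span_seq_is_ideal _) Js.
have {Es} : forall x, x \in s -> ideal_exp P k x.
  by move=> x xs; rewrite Es; apply: sub_ideal_span.
elim: s => [|x s IHs] sP; first by exists [::].
have [J JP Jx] := ideal_exp_prods (sP x (mem_head _ _)).
have [y ys|J' JP' Js] := IHs; first by apply: sP; rewrite inE ys orbT.
exists (J ++ J'); first by move=> t; rewrite mem_cat => /orP[/JP|/JP'].
move=> y; rewrite inE => /predU1P[->|/Js Jy].
  by apply: span_seq_sub Jx; apply: prods_sub => t tJ; rewrite mem_cat tJ.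
by apply: span_seq_sub Jy; apply: prods_sub => t tJ; rewrite mem_cat tJ orbT.
Qed.

Lemma prods_prime P J k x : prime_ideal P -> (forall y, y \in J -> P y) ->
  (0 < k)%N -> x \in prods J k -> P x.
Proof.
case: k => // k PP JP _ /allpairsP[[a b] /= [/JP aP _ ->]].
exact: idealMr (prime_is_ideal PP) aP.
Qed.

(** The product P (gs), presented by generators so that one member of [gs] can be split off. *)
Definition ideal_lincomb P gs : set R :=
  ideal_span [set z | exists a g, [/\ P a, g \in gs & z = a * g]].

Lemma ideal_lincomb_cons P g gs z : is_ideal P -> ideal_lincomb P (g :: gs) z ->
  exists2 c, P c & ideal_lincomb P gs (z - c * g).
Proof.
move=> PI; have LI : is_ideal (ideal_lincomb P gs) by apply: is_ideal_span.
move: z; apply: ideal_span_min.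
  split.
  - exists 0; first exact: ideal0.
    by rewrite mul0r subr0; apply: ideal0.
  - move=> x y [c Pc Lx] [d Pd Ly]; exists (c + d); first exact: (idealD PI).
    have -> : x + y - (c + d) * g = (x - c * g) + (y - d * g) by ring.
    exact: (idealD LI).
  - move=> a x [c Pc Lx]; exists (a * c); first exact: (idealM _ PI).
    have -> : a * x - a * c * g = a * (x - c * g) by ring.
    exact: (idealM _ LI).
move=> _ [a [h [Pa hgs ->]]]; move: hgs; rewrite inE => /predU1P[->|hgs].
  by exists a => //; rewrite subrr; apply: ideal0.
exists 0; first exact: ideal0.
by rewrite mul0r subr0; apply: sub_ideal_span; exists a, h.
Qed.

(** Nakayama's lemma at [P], where [s] is a unit. Some [c] in [P] puts (s - c) g in P times the span
    of the other generators, and s - c is outside [P]; this eliminates [g]. *)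
Lemma nakayama P s gs : prime_ideal P -> ~ P s ->
  (forall g, g \in gs -> ideal_lincomb P gs (s * g)) ->
  exists2 u, ~ P u & forall g, g \in gs -> u * g = 0.
Proof.
move=> PP; have PI := prime_is_ideal PP.
elim: gs s => [|g gs IHgs] s Ps Lgs; first by exists 1; case: PP.
have LI : is_ideal (ideal_lincomb P gs) by apply: is_ideal_span.
have [c Pc Lg] := ideal_lincomb_cons PI (Lgs g (mem_head _ _)).
have Psc : ~ P (s - c).
  by move=> Psc; apply: Ps; rewrite -[s](subrK c); apply: (idealD PI).
have [|h hgs|u Pu ugs] := IHgs ((s - c) * s); first exact: primeM.
  have [|d Pd Lh] := ideal_lincomb_cons PI (Lgs h _); first by rewrite inE hgs orbT.
  have -> : (s - c) * s * h = (s - c) * (s * h - d * g) + d * (s * g - c * g) by ring.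
  by apply: (idealD LI); apply: (idealM _ LI).
have uL : ideal_lincomb P gs `<=` [set z | u * z = 0].
  apply: ideal_span_min.
    split=> [|x y|a x] /=; first by rewrite mulr0.
      by rewrite mulrDr => -> ->; rewrite addr0.
    by rewrite mulrCA => ->; rewrite mulr0.
  by move=> _ [a [h [_ /ugs uh ->]]]; rewrite /= mulrCA uh mulr0.
exists (u * (s - c)); first exact: primeM.
move=> h; rewrite inE => /predU1P[->|/ugs uh].
  by rewrite -mulrA mulrBl; apply: uL.
by rewrite mulrAC uh mul0r.
Qed.

(** The reverse inclusion is formal. This one uses that [loc_ker Q] is prime and contains u a = 0:
    if v u = 0 with [v] outside [Q], then u or v would be in [P]. *)
Lemma loc_ker_mono P Q : prime_ideal P -> prime_ideal (loc_ker Q) -> P `<=` Q ->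
  loc_ker P `<=` loc_ker Q.
Proof.
move=> PP [QI _ QM] PQ a [u Pu ua].
have : loc_ker Q (u * a) by rewrite ua; apply: ideal0.
case/QM=> // [[v Qv vu]]; have : P (v * u).
  by rewrite vu; apply: ideal0 (prime_is_ideal PP).
by case: PP => _ _ PM /PM[/PQ|].
Qed.

End Powers.

(** * Components in the variables outside of a finite set *)

Section Contraction.
Variables (A : comNzRingType) (L : choiceType).
Local Notation Mon := {cmonom L}.
Local Notation R := {malg A[Mon]}.
Implicit Types (f g x : R) (Z : seq L) (K p q : set A) (P : set R).

Lemma monalgU_mulC (c : A) (k : Mon) : << c *g k >> = c%:MP * << k >> :> R.
Proof. by rewrite malgM_def fgmulUU mulr1 mul1m. Qed.

Lemma monomM (a b : Mon) : << mmul a b >> = << a >> * << b >> :> R.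
Proof. by rewrite malgM_def fgmulUU mulr1. Qed.

Definition contraction P : set A := [set a | P a%:MP].

Lemma contraction_prime P : prime_ideal P -> prime_ideal (contraction P).
Proof.
move=> [PI P1 PM]; split.
- split=> [|a b Pa Pb|a b Pb]; rewrite /contraction /=.
  + by rewrite malgC0E; apply: ideal0.
  + by rewrite monalgUD; exact: idealD PI Pa Pb.
  + by rewrite mpolyCM; exact: idealM PI Pb.
- by rewrite /contraction /= mpolyC1E.
- by move=> a b; rewrite /contraction /= mpolyCM => /PM.
Qed.

Lemma ext_contraction_sub P : is_ideal P -> ext_ideal (contraction P) `<=` P.
Proof.
move=> PI f Pf; rewrite [f]monalgE; apply: ideal_sum => // k _ _.
by rewrite monalgU_mulC; apply: (idealMr _ PI); apply: Pf.
Qed.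

Lemma ext_loc_ker p f : prime_ideal p -> ext_ideal (loc_ker p) f ->
  exists2 v, ~ p v & v%:MP * f = 0.
Proof.
move=> pP Kf.
have [k _|v pv vE] := common_annihilator (r := msupp f) (F := fun k => f@_k) pP.
  exact: Kf.
exists v => //; apply/malgP => k; rewrite mcoeffCM mcoeff0.
have [/vE//|/mcoeff_outdom->] := boolP (k \in msupp f); exact: mulr0.
Qed.

Definition vars_in Z (a : Mon) : Mon := [cmonom a z | z in [fset z in Z]%fset]%M.
Definition vars_out Z (a : Mon) : Mon := divcm a (vars_in Z a).

Lemma vars_inE Z a z : vars_in Z a z = if z \in Z then a z else 0%N.
Proof. by rewrite cmE fsfun_fun inE. Qed.

Lemma vars_outE Z a z : vars_out Z a z = if z \in Z then 0%N else a z.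
Proof. by rewrite divcmE vars_inE; case: ifP; rewrite ?subnn ?subn0. Qed.

Lemma vars_inP Z a : in_vars Z (vars_in Z a).
Proof. by move=> z zZ; rewrite vars_inE (negPf zZ). Qed.

Lemma vars_outK Z a : mmul (vars_out Z a) (vars_in Z a) = a.
Proof.
by apply/eqP/cmP => z; rewrite cmM vars_inE vars_outE; case: ifP; rewrite ?addn0.
Qed.

Lemma vars_outM Z a b : in_vars Z b -> vars_out Z (mmul a b) = vars_out Z a.
Proof.
move=> Zb; apply/eqP/cmP => z; rewrite !vars_outE cmM.
by have [//|/Zb->] := boolP (z \in Z); rewrite addn0.
Qed.

Lemma vars_inM Z a b : in_vars Z b -> vars_in Z (mmul a b) = mmul (vars_in Z a) b.
Proof.
move=> Zb; apply/eqP/cmP => z; rewrite cmM !vars_inE cmM.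
by have [//|/Zb->] := boolP (z \in Z).
Qed.

(* The coefficient of the monomial [n] in the variables outside of [Z], for [x]
   viewed as a polynomial over [A[Z]] in those variables. *)
Definition component_monom Z (n a : Mon) : R :=
  if vars_out Z a == n then << vars_in Z a >> else 0.

Lemma component_monomM Z n a b : in_vars Z b ->
  component_monom Z n (mmul a b) = component_monom Z n a * << b >>.
Proof.
move=> Zb; rewrite /component_monom vars_outM // vars_inM //.
by case: (_ == n); [exact: monomM|symmetry; exact: mul0r].
Qed.

Definition component Z n x : R := mmap (@malgC Mon A) (component_monom Z n) x.

Lemma componentE Z n x :
  component Z n x = \sum_(k <- msupp x) (x@_k)%:MP * component_monom Z n k.
Proof. exact: mmapE. Qed.

Lemma component_sum Z n (I : Type) (r : seq I) (F : I -> R) :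
  component Z n (\sum_(i <- r) F i) = \sum_(i <- r) component Z n (F i).
Proof. exact: (raddf_sum (mmap (@malgC Mon A) (component_monom Z n))). Qed.

Lemma component_poly_in Z n x : poly_in Z (component Z n x).
Proof.
move=> a; rewrite componentE -mcoeff_neq0 => ax; apply: contrapT => Za.
case/eqP: ax; rewrite raddf_sum big1_seq //= => k _.
rewrite mcoeffCM /component_monom; case: ifP => _; last by rewrite mcoeff0 mulr0.
rewrite mcoeffU1; case: eqP => [E|]; last by rewrite mulr0.
by case: Za; rewrite -E; apply: vars_inP.
Qed.

(** Multiplying by a monomial in [Z] leaves the part outside [Z] unchanged, so taking components is
    linear over A[Z]. *)
Lemma componentMr Z n x g : poly_in Z g ->
  component Z n (x * g) = component Z n x * g.
Proof.
move=> Zg; rewrite malgME component_sum componentE mulr_suml.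
apply: eq_bigr => k _; rewrite component_sum [X in _ = _ * X]monalgE mulr_sumr.
rewrite big_seq [RHS]big_seq; apply: eq_bigr => b /Zg Zb.
transitivity ((x@_k * g@_b)%:MP * component_monom Z n (mmul k b)).
  exact: mmapU.
rewrite [X in _ = _ * X]monalgU_mulC mpolyCM.
by rewrite (component_monomM n k Zb) [LHS]mulrACA.
Qed.

Lemma sum_component_monom Z (ns : seq Mon) k : uniq ns -> vars_out Z k \in ns ->
  \sum_(n <- ns) << n >> * component_monom Z n k = << k >>.
Proof.
move=> uns kns.
rewrite (eq_bigr (fun n => if n == vars_out Z k then << k >> else 0)); last first.
  move=> n _; rewrite /component_monom eq_sym.
  case: (n =P vars_out Z k) => [->|_]; last exact: mulr0.
  by rewrite -monomM vars_outK.
rewrite (bigD1_seq _ kns uns) /= eqxx big1 => [|n /negPf-> //]; exact: addr0.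
Qed.

(** [x] is the sum of its components times their outer monomials; this reduces membership in [I] to
    the finitely many variables of [Z]. *)
Lemma component_ideal Z (I : set R) x : is_ideal I ->
  (forall n, I (component Z n x)) -> I x.
Proof.
move=> II Ix; pose ns := undup [seq vars_out Z k | k <- msupp x].
suff -> : x = \sum_(n <- ns) << n >> * component Z n x.
  by apply: ideal_sum => // n _ _; apply: (idealM _ II).
transitivity (\sum_(k <- msupp x)
    \sum_(n <- ns) (x@_k)%:MP * (<< n >> * component_monom Z n k)).
  rewrite {1}[x]monalgE big_seq [RHS]big_seq; apply: eq_bigr => k kx.
  rewrite -mulr_sumr sum_component_monom ?undup_uniq ?mem_undup ?map_f //.
  exact: monalgU_mulC.
rewrite exchange_big; apply: eq_bigr => n _.
rewrite componentE [RHS]mulr_sumr; apply: eq_bigr => k _.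
by rewrite [LHS]mulrCA.
Qed.

End Contraction.

(** * Generating the prime ideal *)

Lemma mulr_subM_eq0 (R : comPzRingType) (r x g s : R) :
  r * (x * g - s) = 0 -> r * x * g = r * s.
Proof. by rewrite mulrBr mulrA => /subr0_eq. Qed.

Section ColonIdeal.
Variables (A : comNzRingType) (L : choiceType) (gs hs : seq {malg A[{cmonom L}]}).
Local Notation Mon := {cmonom L}.
Local Notation R := {malg A[Mon]}.
Local Notation m := (1 + size gs * size hs)%N.
Local Notation V := 'rV[R]_m.
Implicit Types (f : V) (x : R) (Z : seq L) (K : set A).

(** A row vector encodes x in its first entry and coefficients y_ij in the others; [residue] is the
    defect of x g_i = sum_j y_ij h_j. Vectors with zero residues project onto the colon ideal (hs) :
    (gs). *)
Definition fst_entry f : R := f 0 (lshift _ ord0).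
Definition snd_entry f i j : R := f 0 (rshift 1 (mxvec_index i j)).

Definition residue f (i : 'I_(size gs)) : R :=
  fst_entry f * tnth (in_tuple gs) i
    - \sum_(j < size hs) snd_entry f i j * tnth (in_tuple hs) j.

Definition relations K : set V := [set f | forall i, ext_ideal K (residue f i)].

Lemma exists_entries (x : R) (y : 'I_(size gs) -> 'I_(size hs) -> R) :
  exists f, fst_entry f = x /\ forall i j, snd_entry f i j = y i j.
Proof.
exists (row_mx x%:M (mxvec (\matrix_(i, j) y i j))); split=> [|i j].
  by rewrite /fst_entry row_mxEl mxE eqxx mulr1n.
by rewrite /snd_entry row_mxEr mxvecE mxE.
Qed.

Lemma residueD f f' i : residue (f + f') i = residue f i + residue f' i.
Proof.
rewrite /residue /fst_entry mxE mulrDl addrACA -opprD -big_split.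
congr (_ - _); apply: eq_bigr => j _.
by rewrite /snd_entry mxE mulrDl.
Qed.

Lemma residueZ r f i : residue (r *: f) i = r * residue f i.
Proof.
rewrite /residue /fst_entry mxE -[in LHS]mulrA [RHS]mulrBr.
congr (_ - _); rewrite [RHS]mulr_sumr; apply: eq_bigr => j _.
by rewrite /snd_entry mxE [RHS]mulrA.
Qed.

Lemma residue_eq0 r f i : r * residue f i = 0 ->
  r * fst_entry f * tnth (in_tuple gs) i
    = \sum_(j < size hs) r * snd_entry f i j * tnth (in_tuple hs) j.
Proof.
move=> rf.
transitivity (r * \sum_(j < size hs) snd_entry f i j * tnth (in_tuple hs) j).
  exact: (@mulr_subM_eq0 R r (fst_entry f) _ _ rf).
rewrite [LHS]mulr_sumr.
by apply: eq_bigr => j _; rewrite [LHS]mulrA.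
Qed.

Lemma submod_relations K : is_ideal K -> submod (relations K).
Proof.
move=> /(@ext_ideal_is_ideal A L)-KI; split.
- by move=> i; rewrite -(scale0r 0) residueZ mul0r; apply: ideal0.
- by move=> f g Kf Kg i; rewrite residueD; apply: (idealD KI).
- by move=> r f Kf i; rewrite residueZ; apply: (idealM _ KI).
Qed.

Lemma relations_saturated K a f : prime_ideal K -> ~ K a ->
  relations K (a%:MP *: f) -> relations K f.
Proof.
move=> KP Ka Kf i k; apply: contrapT => Kk; apply: (primeM KP Ka Kk).
by have := Kf i k; rewrite residueZ mcoeffCM.
Qed.

Lemma exists_bounded Z f : (forall k, poly_in Z (f 0 k)) -> exists d, bounded Z d f.
Proof.
move=> Zf; exists (\max_(k < m) msize (f 0%R k)) => t; rewrite /cf mcoeff_neq0 => tf.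
split; first exact: Zf tf.
exact: leq_trans (ltnW (msize_mdeg_lt tf)) (leq_bigmax t.2).
Qed.

(** Relations modulo the prime [K] form a saturated submodule, so the finiteness theorem handles
    those in the variables [Z]. As [gs] and [hs] involve only [Z], the components of a relation are
    relations, which covers every [x]. *)
Lemma colon_fg K Z (arithA : arithmetical A) : prime_ideal K ->
  (forall g, g \in gs -> poly_in Z g) -> (forall h, h \in hs -> poly_in Z h) ->
  exists G : seq V, (forall f, f \in G -> relations K f) /\
    forall (I : set R) x, is_ideal I -> ext_ideal K `<=` I ->
      (forall f, f \in G -> I (fst_entry f)) ->
      (forall g, g \in gs -> span_seq hs (x * g)) -> I x.
Proof.
move=> KP Zgs Zhs; have KI := prime_is_ideal KP.
have sat a f : ~ K a -> relations K (a%:MP *: f) -> relations K f.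
  exact: relations_saturated KP.
have [G [GS Gspan]] :=
  saturated_submodule_fg Z arithA KP (submod_relations KI) sat.
exists G; split=> // I x II KI' GI xgs; apply: (@component_ideal _ _ Z) => // n.
have /choice[c cE] : forall i : 'I_(size gs), exists c : 'I_(size hs) -> R,
    x * tnth (in_tuple gs) i = \sum_j c j * tnth (in_tuple hs) j.
  by move=> i; apply: span_seq_sum; apply: xgs; exact: mem_tnth.
have [f [f1 f2]] := exists_entries (component Z n x) (fun i j => component Z n (c i j)).
have Zf k : poly_in Z (f 0 k).
  case: (split_ordP k) => k' ->.
    rewrite (ord1 k') -/(fst_entry f) f1; exact: component_poly_in.
  case/mxvec_indexP: k' => i j.
  rewrite -/(snd_entry f i j) f2; exact: component_poly_in.
have Sf : relations K f.
  move=> i; suff -> : residue f i = 0 by exact: ideal0 (ext_ideal_is_ideal _ KI).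
  rewrite /residue f1 -componentMr; last by apply: Zgs; exact: mem_tnth.
  rewrite cE component_sum; apply/eqP; rewrite subr_eq0; apply/eqP.
  apply: eq_bigr => j _; rewrite f2 componentMr //; apply: Zhs; exact: mem_tnth.
have [d bf] := exists_bounded Zf.
have := Gspan d f Sf bf [set f | I (fst_entry f)]; rewrite /= f1; apply.
- split.
  + by change (I (fst_entry 0)); rewrite /fst_entry mxE; apply: ideal0.
  + move=> g g' Ig Ig'; change (I (fst_entry (g + g'))).
    by rewrite /fst_entry mxE; exact: idealD II Ig Ig'.
  + move=> r g Ig; change (I (fst_entry (r *: g))).
    by rewrite /fst_entry mxE; exact: idealM II Ig.
- by move=> g Kg; apply: KI' => a; apply: (Kg (a, lshift _ ord0)).
- exact: GI.
Qed.

End ColonIdeal.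

(** * Lifting generators and conclusion *)

Section Main.
Variables (A : comNzRingType) (L : choiceType).
Local Notation R := {malg A[{cmonom L}]}.
Implicit Types (P Q : set R) (J : seq R) (Z : seq L).

Lemma poly_in1 Z : poly_in Z (1 : R).
Proof. by move=> a; rewrite msuppU1 => /fset1P-> z _; apply: cm1. Qed.

Lemma poly_inM Z (f g : R) : poly_in Z f -> poly_in Z g -> poly_in Z (f * g).
Proof. by move=> Zf Zg a /msuppM_le[b [c [/Zf bZ /Zg cZ ->]]]; apply/in_varsM. Qed.

Lemma exists_common_vars J :
  exists Z, forall k x, x \in prods J k -> poly_in Z x.
Proof.
exists (flatten [seq pvars j | j <- J]); elim=> [|k IHk] x.
  rewrite inE => /eqP->; exact: poly_in1.
move=> /allpairsP[[a b] /= [aJ /IHk Zb ->]]; apply: poly_inM => //.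
apply: poly_in_sub (@poly_in_pvars A L a) => z za.
by apply/flatten_mapP; exists a.
Qed.

Lemma poly_kernel_sub P (f : R) : prime_ideal P ->
  ext_ideal (loc_ker (contraction P)) f -> P f.
Proof.
move=> PP Kf; have cP := contraction_prime PP.
by apply: (ext_contraction_sub (prime_is_ideal PP)) => a; apply: loc_ker_sub cP _ (Kf a).
Qed.

(* Checked at each prime [Q] of [R]: if [Q] contains [P] then the ambient
   localization kills [loc_ker], otherwise some [j] of [J] is a unit at [Q]. *)
Lemma fg_modulo_kernel P J J' :
  reduced A -> arithmetical A -> prime_ideal P ->
  (forall x, x \in J' -> P x) -> {subset J <= J'} ->
  (forall Q, prime_ideal Q -> (forall j, j \in J -> Q j) -> P `<=` Q) ->
  (forall x, P x -> exists2 y, span_seq J' y &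
     ext_ideal (loc_ker (contraction P)) (x - y)) ->
  P = span_seq J'.
Proof.
move=> redA arithA PP JP JJ' JQ Pmod; have SI := span_seq_is_ideal J'.
apply/seteqP; split=> [x Px|]; last exact: span_seq_min (prime_is_ideal PP) JP.
have [y Jy Kz] := Pmod x Px; rewrite -[x](subrK y); apply: (idealD SI) Jy.
move: (x - y) Kz => z Kz {x Px y}.
pose I := [set r : R | span_seq J' (r * z)].
have II : is_ideal I.
  split=> [|r s Ir Is|r s Is]; rewrite /I /=.
  - by rewrite mul0r; apply: ideal0.
  - by rewrite mulrDl; exact: idealD SI Ir Is.
  - by rewrite -mulrA; exact: idealM SI Is.
have [I1|I1] := pselect (I 1); first by rewrite -[z]mul1r.
have [Q QP IQ] := exists_prime II I1.
have PQ : P `<=` Q.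
  apply: JQ => // j jJ; apply: IQ; rewrite /I /= mulrC.
  by apply: (idealM _ SI); apply: mem_span_seq; apply: JJ'.
have cQ := contraction_prime QP; have cP := contraction_prime PP.
have [v Qv vz] : exists2 v, ~ contraction Q v & v%:MP * z = 0.
  apply: ext_loc_ker => // a; apply: loc_ker_mono cP _ _ _ (Kz a).
    exact: loc_ker_prime.
  by move=> c; apply: PQ.
case: Qv; apply: IQ; rewrite /I /= vz; exact: ideal0.
Qed.

End Main.

(* {malg A[{cmonom Lambda}]} is the monoid algebra over A of the free
   commutative monoid on Lambda, i.e. A[X_lambda : lambda in Lambda]. *)
Theorem corollary4p6 (A : comNzRingType) (Lambda : choiceType)
    (redA : reduced A) (arithA : arithmetical A)
    (P : set {malg A[{cmonom Lambda}]}) (primeP : prime_ideal P)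
    (n : nat) (n_gt0 : (0 < n)%N)
    (fgPn : finitely_generated (ideal_exp P n)) :
  finitely_generated P.
Proof.
case: n n_gt0 fgPn => // k _ /fg_ideal_exp[J JP PnJ].
have PI := prime_is_ideal primeP.
have [Z ZJ] := exists_common_vars J.
pose K := loc_ker (contraction P).
have cP := contraction_prime primeP.
have KP : prime_ideal K by apply: loc_ker_prime.
pose KR : set {malg A[{cmonom Lambda}]} := ext_ideal K.
have KRP : prime_ideal KR by apply: ext_ideal_prime.
have KRI := prime_is_ideal KRP.
have KRsub : KR `<=` P by move=> x; apply: poly_kernel_sub.
(* For x in [P], x^(k+1) lies in the ideal of (k+1)-fold products from [J], hence in every prime
   containing [J]. *)
have JQ Q : prime_ideal Q -> (forall j, j \in J -> Q j) -> P `<=` Q.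
  move=> QP QJ x /ideal_exp_expr-/(_ k.+1)/PnJ Jx; apply: (prime_exp (n := k.+1) QP).
  move: Jx; apply: span_seq_min; first exact: prime_is_ideal.
  by move=> y; apply: prods_prime.
suff [J' [J'P JJ' Pmod]] : exists J', [/\ forall x, x \in J' -> P x, {subset J <= J'}
    & forall x, P x -> exists2 y, span_seq J' y & KR (x - y)].
  exists J'; exact: (@fg_modulo_kernel A Lambda P J J').
(* The colon ideal is J^(k+1) : J^k, which contains [P]. *)
have [G [GK Gspan]] := colon_fg arithA KP (ZJ k) (ZJ k.+1).
pose S := @relations A Lambda (prods J k) (prods J k.+1) K.
have [[f [fK Pf]]|Sub] := pselect (exists f, S f /\ ~ P (fst_entry f)).
  (* In this case [P] equals [KR], so 0 approximates every [x]. *)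
  exists J; split=> // x Px; exists 0; first exact: ideal0 (span_seq_is_ideal _).
  rewrite subr0.
  have [i _|v Pv vE] := common_annihilator (r := enum 'I_(size (prods J k)))
      (F := residue f) primeP.
    by have [v Pv vi] := ext_loc_ker cP (fK i); exists v%:MP.
  (* Since [v] kills the residues, [v * fst_entry f] maps J^k into J^(k+1), hence into P J^k, and it
     is outside [P]. *)
  have [|g gJ|u Pu uJ] := @nakayama _ P (v * fst_entry f) (prods J k) primeP.
  - exact: primeM.
  - have /seq_tnthP[i ->] := gJ.
    have LI : is_ideal (ideal_lincomb P (prods J k)) by apply: is_ideal_span.
    have vi := residue_eq0 (vE i (mem_enum _ i)).
    rewrite vi; apply: ideal_sum => [|j _ _]; first exact: LI.
    apply: (idealM _ LI).
    have /allpairsP[[a b] /= [/JP Pa bJ ->]] := mem_tnth j (in_tuple (prods J k.+1)).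
    by apply: sub_ideal_span; exists a, b.
  have Ku : ~ KR u by move=> /KRsub.
  (* [u] kills J^k, hence x^(k+1), and it lies outside the prime [KR]. *)
  apply: (prime_exp (n := k.+1) KRP); apply: contrapT => Kx.
  apply: (primeM KRP Ku Kx).
  suff -> : u * x ^+ k.+1 = 0 by apply: ideal0.
  have := PnJ _ (ideal_exp_expr k.+1 Px).
  move: (x ^+ k.+1); apply: span_seq_min.
    split=> [|y z|a y] /=; first by rewrite mulr0.
      by rewrite mulrDr => -> ->; rewrite addr0.
    by rewrite mulrCA => ->; rewrite mulr0.
  move=> y /allpairsP[[a b] /= [_ /uJ ub ->]].
  by rewrite mulrCA ub mulr0.
have GP f : f \in G -> P (fst_entry f).
  by move=> /GK fK; apply: contrapT => Pf; apply: Sub; exists f.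
(* Here the projected relations lie in [P], and together with [J] they generate it modulo [KR]. *)
exists (J ++ [seq fst_entry f | f <- G]).
have SI := span_seq_is_ideal (J ++ [seq fst_entry f | f <- G]).
split=> [x|x xJ|x Px]; last first.
- pose I := [set z | exists2 y, span_seq (J ++ [seq fst_entry f | f <- G]) y & KR (z - y)].
  apply: (Gspan I) => [|z Kz|f fG|g gJ].
  + split.
    * by exists 0; [apply: ideal0|rewrite subrr; apply: ideal0].
    * move=> z w [y Jy Kz] [y' Jy' Kw]; exists (y + y'); first exact: idealD SI Jy Jy'.
      by rewrite opprD addrACA; exact: idealD KRI Kz Kw.
    * move=> a z [y Jy Kz]; exists (a * y); first exact: idealM SI Jy.
      by rewrite -mulrBr; exact: idealM KRI Kz.
  + by exists 0; [apply: ideal0|rewrite subr0].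
  + exists (fst_entry f); last by rewrite subrr; apply: ideal0.
    by apply: mem_span_seq; rewrite mem_cat map_f // orbT.
  (* x J^k lies in P^(k+1), so [x] belongs to the colon ideal. *)
  + apply: PnJ; apply: sub_ideal_span; exists x, g; split=> //.
    exact: prods_ideal_exp JP gJ.
- by rewrite mem_cat xJ.
- by rewrite mem_cat => /orP[/JP//|/mapP[f /GP Pf ->]].
Qed.
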